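(* Consider the system of ordinary differential equations $$\frac{\mathrm d x_i}{\mathrm d t}=x_i g_i(x),\qquad i\in\{1,\dots,d\},\ x\in C_+,$$ where $g=(g_1,\dots,g_d)\colon C_+\to\mathbb R^d$ is of class $C^1$, $g_i(\mathbf e_i)=0$ for each $1\le i\le d$, and for all $x\in C_+$ all entries of the derivative matrix $\mathrm Dg(x)$ are nonpositive and its diagonal entries are negative. Then the system has a weak carrying simplex, i.e. its time-one map $F=\Phi(1;\cdot)\colon C_+\to C_+$ has a weak carrying simplex. If, moreover, all entries of $\mathrm Dg(x)$ are negative for all $x\in C_+$, then the system (i.e. the map $F$) has a carrying simplex.
   Context: $C_+=\{x\in\mathbb R^d:x_i\ge0\ \forall i\}$; $\mathbf e_i$ is the $i$-th standard basis vector. A $C^1$ map on $C_+$ is one which extends to a $C^1$ map on an open subset of $\mathbb R^d$ containing $C_+$. $\Phi(\cdot;x)$ denotes the unique nonextendible solution of the system with value $x$ at time $0$; under the hypotheses it exists for all $t\ge0$ and stays in $C_+$, so $F=\Phi(1;\cdot)$ is well defined, and it is a Kolmogorov map, i.e. $F_i(x)=x_if_i(x)$ with $f_i(x)=\exp\left(\int_0^1 g_i(\Phi(\tau;x))\,\mathrm d\tau\right)$. Order relations: $x\le y$ if $x_i\le y_i$ for all $i$; $x<y$ if $x\le y$, $x\neq y$. For $I\subset\{1,\dots,d\}$, $(C_I)_+=\{x\in C_+:x_j=0\ \forall j\notin I\}$, and for $x,y\in(C_I)_+$, $x\ll_I y$ means $x_i<y_i$ for all $i\in I$. A set $B\subset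 C_+$ is unordered if no two distinct points of $B$ are related by $<$; it is weakly unordered if for any nonempty $I\subset\{1,\dots,d\}$ no two distinct points of $B\cap(C_I)_+$ are related by $\ll_I$. $\Delta=\{x\in C_+:\sum_ix_i=1\}$; radial projection is $x\mapsto x/\|x\|_1$. $B\subset C_+$ attracts $A\subset C_+$ if for each $\epsilon>0$ there is $n_0$ with $\operatorname{dist}(F^n(x),B)<\epsilon$ for all $n\ge n_0$ and $x\in A$. The compact attractor of bounded sets $\Gamma$ is the (unique, if it exists) nonempty compact $\Gamma\subset C_+$ with $F(\Gamma)=\Gamma$ that attracts every bounded $A\subset C_+$. The carrying simplex [resp. weak carrying simplex] for a Kolmogorov map $F$ is a set $\Sigma\subset C_+$ such that: (i) $\Sigma$ is an unordered [resp. weakly unordered] subset of the compact attractor of bounded sets $\Gamma$; (ii) $\Sigma$ is homeomorphic to $\Delta$ via radial projection; (iii) $F(\Sigma)=\Sigma$ and $F{\restriction}_\Sigma\colon\Sigma\to\Sigma$ is a homeomorphism; (iv) $\Sigma$ attracts any bounded $A\subset C_+$ with $0\notin\bar A$; (v) for any $x\in C_+\setminus\{0\}$ [resp. any $x\in\Gamma\setminus\{0\}$] there is $y\in\Sigma$ with $\lim_{n\to\infty}\|F^n(x)-F^n(y)\|=0$. *)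

(* Defs.v *)
From HB Require Import structures.
From mathcomp Require Import all_boot all_order all_algebra.
From mathcomp Require Import all_classical all_reals all_analysis.

Set Implicit Arguments.
Unset Strict Implicit.
Unset Printing Implicit Defensive.

Import Order.TTheory GRing.Theory Num.Theory.
Import numFieldNormedType.Exports.

Local Open Scope classical_set_scope.
Local Open Scope ring_scope.

Section Orthant.
Context {R : realType} {d : nat}.
Implicit Types (x y : 'rV[R]_d) (A B : set 'rV[R]_d).

Definition orthant : set 'rV[R]_d := [set x | forall i, 0 <= x ord0 i].

Definition face (I : {set 'I_d}) : set 'rV[R]_d :=
  [set x | orthant x /\ forall j, j \notin I -> x ord0 j = 0].

Definition vle x y := forall i, x ord0 i <= y ord0 i.

Definition vlt x y := vle x y /\ x <> y.

Definition vll (I : {set 'I_d}) x y :=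
  forall i, i \in I -> x ord0 i < y ord0 i.

Definition unordered B := forall x y, B x -> B y -> x <> y -> ~ vlt x y.

Definition weakly_unordered B :=
  forall I : {set 'I_d}, I != finset.set0 ->
  forall x y, (B `&` face I) x -> (B `&` face I) y -> x <> y -> ~ vll I x y.

Definition norm1 x : R := \sum_i `|x ord0 i|.

Definition std_simplex : set 'rV[R]_d :=
  [set x | orthant x /\ \sum_i x ord0 i = 1].

(* As 0^-1 = 0, radial_proj 0 = 0 lies outside std_simplex. *)
Definition radial_proj x : 'rV[R]_d := (norm1 x)^-1 *: x.

Definition homeomorphism_on A B (f : 'rV[R]_d -> 'rV[R]_d) :=
  exists h : 'rV[R]_d -> 'rV[R]_d,
    [/\ (forall x, A x -> B (f x) /\ h (f x) = x),
        (forall y, B y -> A (h y) /\ f (h y) = y),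
        {within A, continuous f}
      & {within B, continuous h}].

End Orthant.

Section CarryingSimplex.
Context {R : realType} {d : nat}.
Implicit Types (F : 'rV[R]_d -> 'rV[R]_d) (A B : set 'rV[R]_d).

(* The norm on 'rV[R]_d, hence edist_inf, is the sup norm, and
   edist_inf set0 x = +oo. *)
Definition attracts F B A :=
  forall eps : R, 0 < eps -> exists n0 : nat,
    forall n x, (n0 <= n)%N -> A x -> (edist_inf B (iter n F x) < eps%:E)%E.

Definition compact_attractor F (Gamma : set 'rV[R]_d) :=
  [/\ Gamma !=set0, compact Gamma, Gamma `<=` orthant, F @` Gamma = Gamma
    & forall A, A `<=` orthant -> bounded_set A -> attracts F Gamma A].

Definition simplex_core F (Sigma : set 'rV[R]_d) :=
  [/\ Sigma `<=` orthant,
      homeomorphism_on Sigma std_simplex radial_proj,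
      F @` Sigma = Sigma,
      homeomorphism_on Sigma Sigma F
    & forall A, A `<=` orthant -> bounded_set A -> ~ closure A 0 ->
        attracts F Sigma A].

Definition asymptotically_phased F A Sigma :=
  forall x, A x -> x <> 0 ->
    exists2 y, Sigma y &
      `|iter n F x - iter n F y| @[n --> \oo] --> (0 : R).

Definition carrying_simplex F Sigma :=
  exists2 Gamma, compact_attractor F Gamma &
    [/\ Sigma `<=` Gamma, unordered Sigma, simplex_core F Sigma
      & asymptotically_phased F orthant Sigma].

Definition weak_carrying_simplex F Sigma :=
  exists2 Gamma, compact_attractor F Gamma &
    [/\ Sigma `<=` Gamma, weakly_unordered Sigma, simplex_core F Sigma
      & asymptotically_phased F Gamma Sigma].

End CarryingSimplex.

Section Kolmogorov.
Context {R : realType} {d : nat}.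
Implicit Types (g G : 'rV[R]_d -> 'rV[R]_d) (x : 'rV[R]_d).

(* 'J G x acts on row vectors on the right, hence is the transpose of the usual
   derivative matrix: deriv_mx G x i j is the j-th partial derivative of the
   i-th component of G. *)
Definition deriv_mx G x : 'M[R]_d := ('J G x)^T.

(* G extends g from the orthant to a C^1 map on the open set U. *)
Definition C1_extension g (U : set 'rV[R]_d) G :=
  [/\ open U, orthant `<=` U, (forall x, orthant x -> G x = g x)
    & forall x, U x -> differentiable G x /\ {for x, continuous (deriv_mx G)}].

(* Solutions are defined on open intervals and take values in the orthant; u is
   irrelevant outside J, and g is irrelevant outside the orthant. *)
Definition solution g x (J : set R) (u : R -> 'rV[R]_d) :=
  [/\ open J, is_interval J, J 0, u 0 = x
    & forall t, J t -> orthant (u t) /\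
        forall i, is_derive t (1 : R) (fun s => u s ord0 i)
                    (u t ord0 i * g (u t) ord0 i)].

Definition nonextendible_solution g x J u :=
  solution g x J u /\
  forall J' u', solution g x J' u' -> J `<=` J' ->
    (forall t, J t -> u' t = u t) -> J' = J.

(* The value at time t of the nonextendible solution starting at x, with the
   junk value 0 if there is none or if it is not defined at time t. *)
Definition flow g (t : R) x : 'rV[R]_d :=
  xget 0 [set y | exists J u,
    [/\ nonextendible_solution g x J u, J t & u t = y]].

Definition time_one_map g : 'rV[R]_d -> 'rV[R]_d := flow g 1.

End Kolmogorov.

(* Main.v *)
Require Import Defs.
From HB Require Import structures.
From mathcomp Require Import all_boot all_order all_algebra.
From mathcomp Require Import all_classical all_reals all_analysis.
From mathcomp Require Import ring lra zify.

Set Implicit Arguments.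
Unset Strict Implicit.
Unset Printing Implicit Defensive.

Import Order.TTheory GRing.Theory Num.Theory.
Import numFieldNormedType.Exports.

Local Open Scope classical_set_scope.
Local Open Scope ring_scope.

(* Backwards in time the system is cooperative, hence order-preserving (Kamke):
   if [F x <= F y] then [x <= y], and the ratios [x_i / y_i] do not decrease
   under [F], their increments controlling [F_j y - F_j x] for [j = i], and for
   all [j] in the strict case.  The attractor Gamma is the intersection of the
   [F^n [0,2]^d]; it contains every point below one of its points, and a
   neighbourhood of 0, since 0 is repelling.  Sigma consists of the points of
   Gamma whose backward orbit stays away from 0.  For [x] in Gamma and
   [lam < 1], the ratios between the backward orbits of [lam x] and [x] are
   monotone, hence have vanishing increments, which forces the backward orbit
   of [lam x] to converge to 0.  So every ray meets Sigma exactly once, and no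
   point of Sigma lies strictly below another one.  Finally, a given orbit is
   compared with the orbits of the points of Sigma whose [n]-th iterate is on
   the same ray; in the limit one gets an orbit in Sigma ordered with the given
   one at all times, and the monotone ratios make the difference vanish. *)

(** * Calculus on the real line *)

Section Calculus.
Context {R : realType}.
Implicit Types (a b c t k : R) (f df : R -> R).

(** The argument splits at the record [retrotone]: the sections on retrotone maps use only its
    fields about [F], and the differential equation serves to establish them. The relation [cpl]
    lets one proof serve both claims: it is equality for the weak simplex and the full relation for
    the other. Behind the estimates is the logarithm of u_i / v_i along two ordered solutions. Its
    derivative g_i(u) - g_i(v) is nonnegative, and at least a multiple of v_j - u_j when [cpl i j].
    Coordinates may vanish, so the outcome is stated as an inequality between products. Two
    obstacles shape the rest. Backward solutions may blow up, so [F] need not map onto the orthant: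
    preimages are available only below a value of [F], near a value of [F], or inside an invariant
    set. And in the weak case a ratio controls only its own coordinate. For a point of Gamma the
    limit orbit lies above the given one and vanishes where that one does, so this is enough;
    outside Gamma it lies below and may lose coordinates, which full coupling recovers. *)

Lemma ge0_derive_le f df a b : a <= b ->
  (forall t, a <= t <= b -> is_derive t (1 : R) f (df t)) ->
  (forall t, a <= t <= b -> 0 <= df t) -> f a <= f b.
Proof.
move=> ab fdf df0.
have [||c cab fba] := @MVT_segment R f df a b ab.
- by move=> t /[!in_itv]/= /andP[at_ tb]; apply: fdf; rewrite !ltW.
- apply: derivable_within_continuous => t tab.
  by have [] := fdf t ltac:(by rewrite in_itv in tab).
rewrite -subr_ge0 fba mulr_ge0 ?subr_ge0// df0//.
Qed.

Lemma is_derive_lt0_left f a c D : is_derive c (1 : R) f D -> D < 0 -> a < c ->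
  exists t, [/\ a < t, t < c & f c < f t].
Proof.
move=> [fc fD] D0 ac.
have : \forall h \near 0^', h^-1 *: (f (h *: 1 + c) - f c) < 0.
  by apply: (cvgr_lt D) => //; move: fc; rewrite /derivable -/(derive f c 1) fD.
move=> /nbhs_ballP[e /= e0 he].
pose h := - (Num.min (e / 2) ((c - a) / 2)).
have m0 : 0 < Num.min (e / 2) ((c - a) / 2).
  by rewrite lt_min; apply/andP; split; lra.
have me : Num.min (e / 2) ((c - a) / 2) <= e / 2 by rewrite ge_min lexx.
have ma : Num.min (e / 2) ((c - a) / 2) <= (c - a) / 2 by rewrite ge_min lexx orbT.
have := he h; rewrite /ball/= sub0r normrN /h normrN ger0_norm ?ltW//.
move=> /(_ ltac:(lra)) /(_ ltac:(rewrite oppr_eq0 gt_eqF//)).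
rewrite -/h scaler1 => q.
exists (h + c); split; [rewrite /h; lra|rewrite /h; lra|].
have h0 : h < 0 by rewrite /h; lra.
rewrite -subr_gt0 -(nmulr_rlt0 _ (_ : h^-1 < 0)) ?invr_lt0//.
Qed.

(* At a positive maximum of [expR (- (K + 1) * t) * phi i t] over [i] and
   [t], the derivative would be negative. *)
Lemma max_principle (I : finType) (phi dphi : I -> R -> R) (K a b : R) :
  (forall i t, a <= t <= b -> is_derive t (1 : R) (phi i) (dphi i t)) ->
  (forall i, phi i a <= 0) ->
  (forall i t, a <= t <= b -> 0 < phi i t -> (forall j, phi j t <= phi i t) ->
    dphi i t <= K * phi i t) ->
  forall i t, a <= t <= b -> phi i t <= 0.
Proof.
move=> dphiP phia phiK i0 t0 /andP[at0 t0b].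
rewrite leNgt; apply/negP => phi0.
pose psi i t := expR (- (K + 1) * t) * phi i t.
pose dpsi i t := expR (- (K + 1) * t) * (dphi i t - (K + 1) * phi i t).
have dpsiP i t : a <= t <= b -> is_derive t (1 : R) (psi i) (dpsi i t).
  move=> /dphiP-/(_ i) ?; rewrite /psi; apply: is_derive_eq.
  by rewrite /dpsi /GRing.scale/=; ring.
have [c cP] : {c : I -> R & forall i, a <= c i <= t0 /\
    forall t, a <= t <= t0 -> psi i t <= psi i (c i)}.
  apply: (@choice _ _ (fun i c => a <= c <= t0 /\
    forall t, a <= t <= t0 -> psi i t <= psi i c)) => i.
  have [|c cab cmax] := @EVT_max R (psi i) a t0 at0.
    apply: derivable_within_continuous => t /[!in_itv]/= /andP[at_ tt0].
    by have [] := dpsiP i t ltac:(by rewrite at_ (le_trans tt0)).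
  exists c; split; first by rewrite in_itv in cab.
  by move=> t tab; apply: cmax; rewrite in_itv.
pose m := [arg max_(i > i0) psi i (c i)]%O.
have mP i t : a <= t <= t0 -> psi i t <= psi m (c m).
  move=> tab; rewrite /m; case: arg_maxP => // j _ jmax.
  by apply: le_trans (jmax i isT); apply: (cP i).2.
have [/andP[acm cmt0] _] := cP m.
have cmb : a <= c m <= b by rewrite acm (le_trans cmt0).
have psipos : 0 < psi m (c m).
  by apply: lt_le_trans (mP i0 t0 _); rewrite ?at0 ?lexx// mulr_gt0// expR_gt0.
have phipos : 0 < phi m (c m) by move: psipos; rewrite /psi pmulr_rgt0 ?expR_gt0.
have acm' : a < c m.
  rewrite lt_neqAle acm andbT; apply/eqP => acm'.
  by move: phipos; rewrite -acm' ltNge phia.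
have [|t [at_ tcm]] := @is_derive_lt0_left _ a _ _ (dpsiP m (c m) cmb) _ acm'.
  rewrite /dpsi pmulr_rlt0 ?expR_gt0//.
  have := phiK m (c m) cmb phipos; rewrite mulrDl mul1r => H.
  suff : dphi m (c m) <= K * phi m (c m) by lra.
  apply: H => j; rewrite -(ler_pM2l (expR_gt0 (- (K + 1) * c m))).
  by apply: mP; rewrite acm.
by rewrite ltNge mP// (ltW at_) (le_trans (ltW tcm)).
Qed.

Lemma derive0_eq f a b : a <= b ->
  (forall t, a <= t <= b -> is_derive t (1 : R) f 0) -> f a = f b.
Proof.
move=> ab fdf; apply/eqP; rewrite eq_le; apply/andP; split.
  exact: (@ge0_derive_le f (cst 0)).
rewrite -lerN2; apply: (@ge0_derive_le (- f) (cst 0) a b ab) => // t tab.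
by have ? := fdf t tab; apply: is_derive_eq; rewrite /= oppr0.
Qed.

Lemma lipschitz_continuous f k : (forall s t, `|f s - f t| <= k * `|s - t|) ->
  continuous f.
Proof.
move=> fk t; apply/cvgrPdist_lt => e e0.
have k0 : 0 <= k by have := fk 1 0; rewrite subr0 normr1 mulr1; apply: le_trans.
have d0 : 0 < e / (k + 1) by rewrite divr_gt0// ltr_wpDl.
near=> s; apply: le_lt_trans (fk _ _) _.
have : `|t - s| < e / (k + 1) by near: s; exact: (nbhsx_ballx t _ d0).
rewrite ltr_pdivlMr ?ltr_wpDl// => H.
apply: le_lt_trans H; rewrite mulrC ler_wpM2l//; lra.
Unshelve. all: by end_near. Qed.

Lemma primitive_exists_gt (h : R -> R) T : continuous h ->
  exists A : R -> R, forall t, T < t -> is_derive t (1 : R) A (h t).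
Proof.
move=> hc.
exists (fun x => (\int[lebesgue_measure]_(t in `[T, x]) h t)%R) => t Tt.
have [||||dA A'] := @continuous_FTC1_closed R h T t (t + 1).
- by rewrite ltrDl.
- apply: continuous_compact_integrable; first exact: segment_compact.
  exact: continuous_subspaceT.
- exact: Tt.
- exact: hc.
by apply: DeriveDef => //; rewrite -derive1E.
Qed.

(** An integral from a base point is differentiated only to the right of that point. So the base
    point moves with [t], to the left of both [t] and 0; the primitives obtained, normalised at 0,
    agree where they overlap. *)
Lemma primitive_exists (h : R -> R) : continuous h ->
  exists A : R -> R, A 0 = 0 /\ forall t, is_derive t (1 : R) A (h t).
Proof.
move=> hc.
have [B BP] := @choice _ _ (fun T A => forall t, T < t ->
  is_derive t (1 : R) (A : R -> R) (h t)) (fun T => primitive_exists_gt T hc).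
pose A t := B (- (`|t| + 1)) t - B (- (`|t| + 1)) 0.
have AE T t : 0 < T -> `|t| < T -> A t = B (- T) t - B (- T) 0.
  move=> T0 tT.
  have T1 : 0 < `|t| + 1 by rewrite ltr_wpDl.
  have D s : - T < s -> - (`|t| + 1) < s ->
      is_derive s (1 : R) (B (- (`|t| + 1)) - B (- T)) 0.
    move=> /BP ? /BP ?; apply: is_derive_eq; exact: subrr.
  suff : (B (- (`|t| + 1)) - B (- T)) t = (B (- (`|t| + 1)) - B (- T)) 0.
    by rewrite /A !fctE; lra.
  have := ler_norm t; have := ler_norm (- t); rewrite normrN => ? ?.
  have [t0|/ltW t0] := leP 0 t.
    by apply/esym/derive0_eq => // s /andP[? ?]; apply: D; lra.
  by apply/derive0_eq => // s /andP[? ?]; apply: D; lra.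
exists A; split; first by rewrite /A normr0 subrr.
move=> t; pose T := `|t| + 1.
have T0 : 0 < T by rewrite ltr_wpDl.
have Tt : - T < t by rewrite /T; have := ler_norm (- t); rewrite normrN; lra.
have ? := BP (- T) t Tt.
apply: (@near_eq_is_derive _ _ _ (B (- T) - cst (B (- T) 0))).
- near=> s; rewrite !fctE (AE T)//.
  apply: (@le_lt_trans _ _ (`|t| + `|s - t|)).
    by rewrite -{1}(subrK t s) addrC ler_normD.
  rewrite ltrD2l distrC; near: s.
  exact: (nbhsx_ballx t _ ltr01).
- by apply: is_derive_eq; rewrite subr0.
Unshelve. all: by end_near. Qed.

End Calculus.

(** * Global solutions of Lipschitz systems *)

Section RowNorm.
Context {R : realType} {d : nat}.
Implicit Types (x : 'rV[R]_d).

Lemma row_norm_le x e : 0 <= e -> (forall i, `|x ord0 i| <= e) -> `|x| <= e.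
Proof.
move=> e0 xe; rewrite [leLHS]/Num.norm /= mx_normrE; apply/bigmax_leP; split => //.
by move=> [i j] _ /=; rewrite ord1.
Qed.

Lemma coord_le_norm x i : `|x ord0 i| <= `|x|.
Proof.
rewrite [leRHS]/Num.norm /= mx_normrE; apply/bigmax_geP; right.
by exists (ord0, i).
Qed.

End RowNorm.

Section Geometric.
Context {R : realType}.
Implicit Types (x k : R) (u : nat -> R).

Lemma geometric_small k e : 0 < e -> exists n, k / 2 ^+ n < e.
Proof.
move=> e0; exists (Num.bound `|k / e|); rewrite ltr_pdivrMr ?exprn_gt0// mulrC -ltr_pdivrMr//.
apply: le_lt_trans (ler_norm _) _; apply: lt_le_trans (archi_boundP _) _ => //.
by rewrite -natrX ler_nat; exact: ltnW (ltn_expl _ (ltnSn 1)).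
Qed.

Lemma geometric_eq0 x k : (forall n, `|x| <= k / 2 ^+ n) -> x = 0.
Proof.
move=> xk; apply/eqP; rewrite -normr_le0 leNgt; apply/negP => x0.
have [n] := geometric_small k x0.
by rewrite ltNge xk.
Qed.

(** The intervals of centre [u n] and radius [2 * k / 2 ^+ n] are nested, and the supremum of their
    left ends lies in all of them. The explicit rate is what the Picard iteration consumes. *)
Lemma geometric_cauchy u k : (forall n, `|u n.+1 - u n| <= k / 2 ^+ n) ->
  exists l, forall n, `|u n - l| <= 2 * k / 2 ^+ n.
Proof.
move=> uk.
have pow n : 2 * k / 2 ^+ n = k / 2 ^+ n + 2 * k / 2 ^+ n.+1.
  by rewrite exprS; field; rewrite expf_neq0//.
have k0 : 0 <= k by have := uk 0%N; rewrite expr0 divr1; apply: le_trans.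
pose a n := u n - 2 * k / 2 ^+ n; pose b n := u n + 2 * k / 2 ^+ n.
have stp n : a n <= a n.+1 /\ b n.+1 <= b n.
  have := uk n; rewrite ler_norml /a /b => /andP[]; rewrite (pow n).
  by move=> ? ?; split; lra.
have am m n : a m <= a (m + n)%N.
  by elim: n => [|n IH]; rewrite ?addn0// addnS (le_trans IH)//; apply: (stp _).1.
have bm m n : b (m + n)%N <= b m.
  by elim: n => [|n IH]; rewrite ?addn0// addnS (le_trans _ IH)//; apply: (stp _).2.
have ab m n : a m <= b n.
  apply: le_trans (am m n) _; apply: le_trans (bm n m); rewrite addnC /a /b.
  have : 0 <= 2 * k / 2 ^+ (n + m) by rewrite divr_ge0 ?exprn_ge0// mulr_ge0.
  by lra.
exists (sup (range a)) => n.
have hs : has_sup (range a).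
  split; first by exists (a 0%N), 0%N.
  by exists (b 0%N) => _ [m _ <-].
have h1 : a n <= sup (range a) by apply: ub_le_sup; [exact: hs.2|exists n].
have h2 : sup (range a) <= b n by apply: ge_sup; [exact: hs.1|move=> _ [m _ <-]].
by rewrite ler_norml; move: h1 h2; rewrite /a /b => ? ?; apply/andP; split; lra.
Qed.

End Geometric.

Section Picard.
Context {R : realType} {d : nat}.
Variables (H : 'rV[R]_d -> 'rV[R]_d) (L B : R).
Hypothesis L0 : 0 < L.
Hypothesis B0 : 0 < B.
Hypothesis H_lip : forall x y i, `|H x ord0 i - H y ord0 i| <= L * `|x - y|.
Hypothesis H_bd : forall x i, `|H x ord0 i| <= B.

(** Integrating against this exponential weight gains a factor [1 / (2 * L)]. With a field of
    Lipschitz constant [L], the Picard map therefore halves weighted distances on the whole line at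
    once (Bielecki's norm). Negative times and lower bounds reduce to [main] by reflections. *)
Lemma expR_bound (f df : R -> R) k : f 0 = 0 ->
  (forall t, is_derive t (1 : R) f (df t)) ->
  (forall t, `|df t| <= k * expR (2 * L * `|t|)) ->
  forall t, `|f t| <= k / (2 * L) * expR (2 * L * `|t|).
Proof.
have main (h dh : R -> R) : h 0 = 0 ->
    (forall t, is_derive t (1 : R) h (dh t)) ->
    (forall t, 0 <= t -> dh t <= k * expR (2 * L * t)) -> 0 <= k ->
    forall t, 0 <= t -> h t <= k / (2 * L) * expR (2 * L * t).
  move=> h0 dhP dhk k0 t t0.
  pose q s := k / (2 * L) * expR (2 * L * s) - h s.
  have : q 0 <= q t.
    apply: (@ge0_derive_le _ q (fun s => k * expR (2 * L * s) - dh s)) => //.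
    - move=> s _; rewrite /q; have ? := dhP s; apply: is_derive_eq.
      by rewrite /GRing.scale/=; field; rewrite gt_eqF.
    - by move=> s /andP[s0 _]; rewrite subr_ge0 dhk.
  rewrite /q h0 mulr0 expR0 mulr1 subr0 => H1.
  have : 0 <= k / (2 * L) by rewrite divr_ge0// mulr_ge0// ltW.
  by lra.
move=> f0 dfP dfk t.
have k0 : 0 <= k.
  by have := dfk 0; rewrite normr0 mulr0 expR0 mulr1; apply: le_trans.
have dN (h dh : R -> R) : (forall t, is_derive t (1 : R) h (dh t)) ->
    forall t, is_derive t (1 : R) (fun s => h (- s)) (- dh (- t)).
  move=> hP s; have ? := hP (- s).
  by apply: is_derive_eq; rewrite /GRing.scale/=; ring.
have dO (h dh : R -> R) : (forall t, is_derive t (1 : R) h (dh t)) ->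
    forall t, is_derive t (1 : R) (fun s => - h s) (- dh t).
  by move=> hP s; have ? := hP s; apply: is_derive_eq.
have bd s : 0 <= s -> `|df s| <= k * expR (2 * L * s).
  by move=> s0; have := dfk s; rewrite (ger0_norm s0).
have bdN s : 0 <= s -> `|df (- s)| <= k * expR (2 * L * s).
  by move=> s0; have := dfk (- s); rewrite normrN (ger0_norm s0).
have [t0|/ltW t0] := leP 0 t.
  rewrite (ger0_norm t0) ler_norml lerNl; apply/andP; split.
    apply: (main (fun s => - f s) (fun s => - df s)) => //; rewrite ?f0 ?oppr0//.
    by move=> s s0; apply: le_trans (bd s s0); rewrite -normrN ler_norm.
  apply: (main f df) => // s s0; apply: le_trans (bd s s0); exact: ler_norm.
have t0' : 0 <= - t by rewrite oppr_ge0.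
rewrite (ler0_norm t0) ler_norml lerNl; apply/andP; split.
  have := main (fun s => - f (- s)) (fun s => - - df (- s)) _ _ _ k0 (- t) t0'.
  rewrite opprK; apply; first by rewrite oppr0 f0 oppr0.
  by move=> s s0; rewrite opprK; apply: le_trans (bdN s s0); exact: ler_norm.
have := main (fun s => f (- s)) (fun s => - df (- s)) _ _ _ k0 (- t) t0'.
rewrite opprK; apply; first by rewrite oppr0.
by move=> s s0; apply: le_trans (bdN s s0); rewrite -normrN; exact: ler_norm.
Qed.

(** The iterate inherits the Lipschitz constant [B] from the bound on [H], so the next integrand is
    again continuous and the step can be repeated. *)
Lemma picard_step (w : R -> 'rV[R]_d) : (forall s t, `|w s - w t| <= B * `|s - t|) ->
  exists z : R -> 'rV[R]_d, [/\ z 0 = 0,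
    forall t i, is_derive t (1 : R) (fun s => z s ord0 i) (H (w t) ord0 i) &
    forall s t, `|z s - z t| <= B * `|s - t|].
Proof.
move=> w_lip.
have hc i : continuous (fun t => H (w t) ord0 i).
  apply: (@lipschitz_continuous _ _ (L * B)) => s t; apply: le_trans (H_lip _ _ _) _.
  by rewrite -mulrA ler_wpM2l// ltW.
have [A AP] := @choice _ _ (fun i A => A 0 = 0 /\ forall t,
  is_derive t (1 : R) (A : R -> R) (H (w t) ord0 i)) (fun i => primitive_exists (hc i)).
exists (fun t => \row_i A i t); split.
- by apply/rowP => i; rewrite !mxE (AP i).1.
- move=> t i; under eq_fun do rewrite mxE; exact: (AP i).2.
have main i a b c : `|c| <= 1 -> a <= b -> c * (A i b - A i a) <= B * (b - a).
  move=> c1 ab.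
  have : B * a - c * A i a <= B * b - c * A i b.
    apply: (@ge0_derive_le _ (fun s => B * s - c * A i s)
                          (fun s => B - c * H (w s) ord0 i)) => //.
    - move=> t _; have ? := (AP i).2 t; apply: is_derive_eq.
      by rewrite /GRing.scale/=; ring.
    - move=> t _; rewrite subr_ge0; apply: le_trans (ler_norm _) _.
      rewrite normrM; apply: le_trans (H_bd (w t) i).
      by rewrite ler_piMl.
  by lra.
move=> s t; apply: row_norm_le => [|j]; first by rewrite mulr_ge0// ltW.
rewrite !mxE; have [st|/ltW st] := leP s t.
  rewrite distrC (distrC s) (ger0_norm (_ : 0 <= t - s)) ?subr_ge0//.
  rewrite ler_norml lerNl; apply/andP; split.
    by have := main j s t (-1); rewrite normrN normr1 mulN1r; apply.
  by have := main j s t 1; rewrite normr1 mul1r; apply.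
rewrite (ger0_norm (_ : 0 <= s - t)) ?subr_ge0//.
rewrite ler_norml lerNl; apply/andP; split.
  by have := main j t s (-1); rewrite normrN normr1 mulN1r; apply.
by have := main j t s 1; rewrite normr1 mul1r; apply.
Qed.

Lemma picard : exists w : R -> 'rV[R]_d, [/\ w 0 = 0,
    forall t i, is_derive t (1 : R) (fun s => w s ord0 i) (H (w t) ord0 i) &
    forall s t, `|w s - w t| <= B * `|s - t|].
Proof.
pose lip (w : R -> 'rV[R]_d) := forall s t, `|w s - w t| <= B * `|s - t|.
pose next (w z : R -> 'rV[R]_d) := [/\ z 0 = 0,
  forall t i, is_derive t (1 : R) (fun s => z s ord0 i) (H (w t) ord0 i) & lip z].
have [Phi PhiP] : {Phi & forall w, lip w -> next w (Phi w)}.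
  apply: (@choice _ _ (fun w z => lip w -> next w z)) => w.
  have [wl|] := pselect (lip w); last by exists w.
  by have [z zP] := picard_step wl; exists z.
pose W n := iter n Phi (fun=> 0).
have Wlip n : lip (W n).
  elim: n => [s t|n IH]; last by have [] := PhiP _ IH.
  by rewrite subrr normr0 mulr_ge0// ltW.
have WP n : next (W n) (W n.+1) by apply: PhiP.
pose E (t : R) := expR (2 * L * `|t|).
have step n : forall t, `|W n.+1 t - W n t| <= B / L / 2 ^+ n * E t.
  elim: n => [|n IH] t.
    have [W0 _ W1] := WP 0%N; have := W1 t 0; rewrite W0 !subr0 => H1.
    apply: le_trans H1 _; rewrite expr0 divr1 -mulrA (ler_wpM2l (ltW B0))//.
    rewrite ler_pdivlMl//.
    have := expR_ge1Dx (2 * L * `|t|); rewrite -/(E t).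
    have : 0 <= L * `|t| by rewrite mulr_ge0// ltW.
    by lra.
  have E0 : 0 <= E t by rewrite expR_ge0.
  apply: row_norm_le => [|i].
    by rewrite !mulr_ge0// ?invr_ge0 ?exprn_ge0 ?ltW.
  have [W10 W1 _] := WP n; have [W20 W2 _] := WP n.+1.
  have := @expR_bound (fun s => W n.+2 s ord0 i - W n.+1 s ord0 i)
    (fun s => H (W n.+1 s) ord0 i - H (W n s) ord0 i) (B / 2 ^+ n) _ _ _ t.
  rewrite !mxE -/(E t).
  rewrite (_ : B / 2 ^+ n / (2 * L) = B / L / 2 ^+ n.+1); last first.
    by rewrite exprS; field; rewrite ?expf_neq0 ?gt_eqF.
  apply.
  - by rewrite W10 W20 subrr.
  - move=> s; apply: le_trans (H_lip _ _ _) _; rewrite -/(E s).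
    apply: le_trans (ler_wpM2l (ltW L0) (IH s)) _.
    by rewrite mulrA (_ : L * (B / L / 2 ^+ n) = B / 2 ^+ n)//; field;
      rewrite ?expf_neq0 ?gt_eqF.
have [w wP] : {w : R -> 'rV[R]_d & forall t n,
    `|W n t - w t| <= 2 * (B / L * E t) / 2 ^+ n}.
  apply: (@choice _ _ (fun t wt => forall n,
      `|W n t - wt| <= 2 * (B / L * E t) / 2 ^+ n)) => t.
  have [l lP] : {l : 'I_d -> R & forall i n,
      `|W n t ord0 i - l i| <= 2 * (B / L * E t) / 2 ^+ n}.
    apply: (@choice _ _ (fun i l => forall n,
       `|W n t ord0 i - l| <= 2 * (B / L * E t) / 2 ^+ n)) => i.
    apply: geometric_cauchy => n; have := step n t.
    rewrite mulrAC; apply: le_trans.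
    by have := coord_le_norm (W n.+1 t - W n t) i; rewrite !mxE.
  exists (\row_i l i) => n; apply: row_norm_le => [|i]; last by rewrite !mxE.
  by rewrite !mulr_ge0// ?invr_ge0 ?exprn_ge0 ?expR_ge0// ltW.
have wlip : lip w.
  move=> s t; rewrite leNgt; apply/negP; rewrite -subr_gt0.
  set e := _ - _ => e0.
  have [n] := geometric_small (2 * (B / L * E s) + 2 * (B / L * E t)) e0.
  rewrite mulrDl ltNge => /negP; apply.
  have := Wlip n s t; have := wP s n; have := wP t n; rewrite /e.
  have -> : w s - w t = - (W n s - w s) + (W n s - W n t) + (W n t - w t).
    by apply/rowP => j; rewrite !mxE; ring.
  have := ler_normD (- (W n s - w s) + (W n s - W n t)) (W n t - w t).
  have := ler_normD (- (W n s - w s)) (W n s - W n t); rewrite normrN.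
  by lra.
(* The limit equals its own Picard iterate [z], because [W n.+1] is close to both: to [w] by
   convergence, to [z] by [expR_bound]. *)
have [z [z0 zP zl]] := picard_step wlip.
suff wz : w = z by exists z; split => // t i; have := zP t i; rewrite wz.
apply/funext => t; apply/rowP => i; apply/eqP; rewrite -subr_eq0; apply/eqP.
apply: (@geometric_eq0 _ _ (2 * (B / L * E t))) => n.
have zW : `|W n.+1 t ord0 i - z t ord0 i| <= B / L * E t / 2 ^+ n.
  have [W10 W1 _] := WP n.
  have := @expR_bound (fun s => W n.+1 s ord0 i - z s ord0 i)
    (fun s => H (W n s) ord0 i - H (w s) ord0 i) (2 * B / 2 ^+ n) _ _ _ t.
  rewrite -/(E t).
  rewrite (_ : 2 * B / 2 ^+ n / (2 * L) * E t = B / L * E t / 2 ^+ n); last first.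
    by field; rewrite ?expf_neq0 ?gt_eqF.
  apply.
  - by rewrite W10 z0 subrr.
  - move=> s; apply: le_trans (H_lip _ _ _) _; rewrite -/(E s).
    apply: le_trans (ler_wpM2l (ltW L0) (wP s n)) _.
    rewrite (_ : L * (2 * (B / L * E s) / 2 ^+ n) = 2 * B / 2 ^+ n * E s)//; field.
    by rewrite ?expf_neq0 ?gt_eqF.
have := le_trans (coord_le_norm _ i) (wP t n.+1); rewrite !mxE.
have -> : 2 * (B / L * E t) / 2 ^+ n.+1 = B / L * E t / 2 ^+ n.
  by rewrite exprS; field; rewrite ?expf_neq0 ?gt_eqF.
move: zW; set x := W n.+1 t ord0 i => xz xw.
have -> : w t ord0 i - z t ord0 i = - (x - w t ord0 i) + (x - z t ord0 i) by ring.
apply: le_trans (ler_normD _ _) _; rewrite normrN.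
by rewrite -mulrA; lra.
Qed.

End Picard.

(** * The flow of a Kolmogorov system *)

Section Box.
Context {R : realType} {d : nat}.
Implicit Types (x y w : 'rV[R]_d) (M : R).

Definition box M : set 'rV[R]_d := [set x | forall i, 0 <= x ord0 i <= M].

(** Cut off only from above, since [scale_exp] already keeps points in the orthant. *)
Definition trunc M x : 'rV[R]_d := \row_i Num.min (x ord0 i) M.

Definition scale_exp x w : 'rV[R]_d := \row_i (x ord0 i * expR (w ord0 i)).

Lemma box_orthant M x : box M x -> orthant x.
Proof. by move=> xM i; have /andP[] := xM i. Qed.

Lemma orthant_box x : orthant x -> exists2 M, 1 <= M & box M x.
Proof.
move=> x0; exists (1 + `|x|) => [|i]; first by rewrite lerDl.
by rewrite x0 /= (le_trans (ler_norm _))// (le_trans (coord_le_norm _ _))// lerDr.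
Qed.

Lemma box_sub M N x : M <= N -> box M x -> box N x.
Proof. by move=> MN xM i; have /andP[-> /le_trans->] := xM i. Qed.

Lemma box_vle M x y : orthant x -> vle x y -> box M y -> box M x.
Proof. by move=> x0 xy yM i; rewrite x0 /= (le_trans (xy i))//; case/andP: (yM i). Qed.

Lemma box_norm M x : 0 <= M -> box M x -> `|x| <= M.
Proof.
by move=> M0 xM; apply: row_norm_le => // i; have /andP[? ?] := xM i; rewrite ger0_norm.
Qed.

Lemma trunc_box M x : 0 <= M -> orthant x -> box M (trunc M x).
Proof. by move=> M0 x0 i; rewrite mxE le_min x0 M0 ge_min lexx orbT. Qed.

Lemma trunc_id M x : box M x -> trunc M x = x.
Proof.
by move=> xM; apply/rowP => i; rewrite mxE; apply/min_idPl; have /andP[] := xM i.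
Qed.

Lemma scale_exp_ge0 x w : orthant x -> orthant (scale_exp x w).
Proof. by move=> x0 i; rewrite mxE mulr_ge0// expR_ge0. Qed.

Lemma min_dist (a b M : R) : b <= M -> `|Num.min a M - b| <= `|a - b|.
Proof.
move=> bM; rewrite minEle; case: ifPn => //; rewrite -ltNge => Ma.
by rewrite !ger0_norm ?subr_ge0 ?(le_trans bM (ltW Ma))// lerD2r ltW.
Qed.

(** The derivative of [x * expR a] in [a] is its own value, which is at most [M] where the cut-off
    is inactive; this makes the constant independent of [x]. *)
Lemma min_expR_lip (x M a b : R) : 0 <= x -> 0 <= M ->
  `|Num.min (x * expR a) M - Num.min (x * expR b) M| <= M * `|a - b|.
Proof.
move=> x0 M0; wlog ab : a b / a <= b.
  by move=> H; have [/H//|/ltW/H] := leP a b; rewrite distrC (distrC a).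
have xab : x * expR a <= x * expR b by rewrite ler_wpM2l// ler_expR.
have [Ma|Ma] := leP M (x * expR a).
  have -> : Num.min (x * expR b) M = M by apply/min_idPr/(le_trans Ma).
  rewrite subrr normr0.
  by rewrite mulr_ge0.
rewrite distrC (distrC a) !ger0_norm ?subr_ge0//; last first.
  by rewrite le_min xab ltW.
set m := Num.min _ M.
have mM : m <= M by rewrite /m ge_min lexx orbT.
have m0 : 0 <= m by rewrite /m le_min M0 mulr_ge0// expR_ge0.
have mb : m <= x * expR b by rewrite /m ge_min lexx.
have xa : m * expR (a - b) <= x * expR a.
  apply: le_trans (ler_wpM2r (expR_ge0 _) mb) _.
  by rewrite -mulrA -expRD (addrC b) subrK.
have := expR_ge1Dx (a - b) => h1.
have h2 : m * (1 + (a - b)) <= m * expR (a - b) by rewrite ler_wpM2l.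
have h3 : m * (b - a) <= M * (b - a) by rewrite ler_wpM2r// subr_ge0.
by lra.
Qed.

End Box.

Section Kolmogorov.
Context {R : realType} {d : nat}.
Variable g : 'rV[R]_d -> 'rV[R]_d.
Implicit Types (x y z : 'rV[R]_d) (u v : R -> 'rV[R]_d) (M : R).
Hypothesis g_lip : forall M, 0 < M -> exists2 L, 0 < L &
  forall x y, box M x -> box M y ->
  forall i, `|g x ord0 i - g y ord0 i| <= L * `|x - y|.
Hypothesis g_anti : forall x y, orthant x -> vle x y ->
  forall i, g y ord0 i <= g x ord0 i.
Hypothesis g_axis : forall i, g (delta_mx ord0 i) ord0 i = 0.

Lemma g_bounded M : 0 < M -> exists2 B, 0 < B &
  forall x, box M x -> forall i, `|g x ord0 i| <= B.
Proof.
move=> M0; have [L L0 gL] := g_lip M0.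
exists (1 + (`|g 0| + L * M)) => [|x xM i].
  by rewrite ltr_pwDl// addr_ge0// mulr_ge0// ltW.
have b0 : box M (0 : 'rV[R]_d) by move=> j; rewrite mxE lexx ltW.
have := gL x 0 xM b0 i; rewrite subr0 => h.
have h1 : L * `|x| <= L * M by rewrite ler_wpM2l ?box_norm// ltW.
have := coord_le_norm (g 0) i => h2.
rewrite -(subrK (g 0 ord0 i) (g x ord0 i)).
by apply: le_trans (ler_normD _ _) _; lra.
Qed.

(* With [u i = x i * expR (w i)] the truncated field is globally Lipschitz in
   [w], and the orthant and its faces are invariant by construction. *)
Lemma truncated_exists M : 0 < M -> exists2 B, 0 < B &
  forall (s : R) x, `|s| = 1 -> orthant x -> exists w : R -> 'rV[R]_d,
  [/\ w 0 = 0,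
    forall t i, is_derive t (1 : R) (fun r => w r ord0 i)
      (s * g (trunc M (scale_exp x (w t))) ord0 i) &
    forall t i, `|w t ord0 i| <= B * `|t|].
Proof.
move=> M0; have [B B0 gB] := g_bounded M0; have [L L0 gL] := g_lip M0.
exists B => // s x s1 x0.
pose H w : 'rV[R]_d := \row_i (s * g (trunc M (scale_exp x w)) ord0 i).
have tb w : box M (trunc M (scale_exp x w)).
  by apply: trunc_box (ltW M0) _; apply: scale_exp_ge0.
have [||w [w0 wP wB]] := @picard R d H (L * M) B (mulr_gt0 L0 M0) B0.
- move=> a b i; rewrite !mxE -mulrBr normrM s1 mul1r.
  apply: le_trans (gL _ _ (tb a) (tb b) i) _; rewrite -mulrA (ler_wpM2l (ltW L0))//.
  apply: row_norm_le => [|j]; first by rewrite mulr_ge0// ltW.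
  rewrite !mxE; apply: le_trans (min_expR_lip _ _ (x0 j) (ltW M0)) _.
  rewrite (ler_wpM2l (ltW M0))//; apply: le_trans (coord_le_norm _ j).
  by rewrite !mxE.
- by move=> a i; rewrite mxE normrM s1 mul1r gB.
exists w; split => // [t i|t i]; first by have := wP t i; rewrite mxE.
have := wB t 0; rewrite w0 !subr0; apply: le_trans; exact: coord_le_norm.
Qed.

Lemma scale_exp_derive x (w : R -> 'rV[R]_d) (h : R) t i :
  is_derive t (1 : R) (fun r => w r ord0 i) h ->
  is_derive t (1 : R) (fun r => scale_exp x (w r) ord0 i)
    (scale_exp x (w t) ord0 i * h).
Proof.
move=> wh; rewrite !mxE; under eq_fun do rewrite mxE.
by apply: is_derive_eq; rewrite /GRing.scale/=; ring.
Qed.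

(* [s = -1] is the system with time reversed; the growth rates are evaluated at
   [uh] so that truncated systems are covered as well. *)
Definition kolm_on (s a b : R) (u uh : R -> 'rV[R]_d) :=
  forall t, a <= t <= b -> forall i,
    is_derive t (1 : R) (fun r => u r ord0 i) (s * (u t ord0 i * g (uh t) ord0 i)).

(** The constant [B + M * L] comes from writing u g(uh) - v g(v) as (u - v) g(uh) + v (g(uh) -
    g(v)). Pairs of an index and a sign let [max_principle] bound all absolute values together. By
    [min_dist], a truncation [uh] of [u] is no farther from [v] than [u] is. *)
Lemma gronwall M : 0 < M -> exists2 K, 0 <= K & forall (s a b : R) u uh v,
  `|s| = 1 -> kolm_on s a b u uh -> kolm_on s a b v v ->
  (forall t, a <= t <= b -> box M (uh t) /\ box M (v t)) ->
  (forall t, a <= t <= b -> forall i,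
     `|uh t ord0 i - v t ord0 i| <= `|u t ord0 i - v t ord0 i|) ->
  forall t, a <= t <= b -> forall i,
    `|u t ord0 i - v t ord0 i| <= `|u a - v a| * expR (K * (t - a)).
Proof.
move=> M0; have [B B0 gB] := g_bounded M0; have [L L0 gL] := g_lip M0.
exists (B + M * L) => [|s a b u uh v s1 uP vP bx uhP t tab i].
  by rewrite addr_ge0 ?mulr_ge0// ltW.
pose K := B + M * L.
pose sgn (e : bool) : R := if e then 1 else -1.
have sgn1 e : `|sgn e| = 1 by case: e; rewrite /sgn ?normrN normr1.
pose phi (p : 'I_d * bool) r := sgn p.2 * (u r ord0 p.1 - v r ord0 p.1)
   - `|u a - v a| * expR (K * (r - a)).
pose dphi (p : 'I_d * bool) r := sgn p.2 *
   (s * (u r ord0 p.1 * g (uh r) ord0 p.1) - s * (v r ord0 p.1 * g (v r) ord0 p.1))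
   - K * (`|u a - v a| * expR (K * (r - a))).
have main : forall p r, a <= r <= b -> phi p r <= 0.
  apply: (@max_principle R _ phi dphi K a b).
  - move=> [j e] r rab /=; rewrite /phi /dphi /=.
    have ? := uP r rab j; have ? := vP r rab j.
    by apply: is_derive_eq; rewrite /GRing.scale/=; ring.
  - move=> [j e]; rewrite /phi /= subrr mulr0 expR0 mulr1 subr_le0.
    apply: le_trans (ler_norm _) _; rewrite normrM sgn1 mul1r.
    by apply: le_trans (coord_le_norm _ j); rewrite !mxE.
  - move=> [j e] r rab phi0 phimax.
    pose m := sgn e * (u r ord0 j - v r ord0 j).
    have E0 : 0 <= `|u a - v a| * expR (K * (r - a)) by rewrite mulr_ge0// expR_ge0.
    have m0 : 0 < m by move: phi0; rewrite /phi /= -/m => h; lra.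
    have um k : `|u r ord0 k - v r ord0 k| <= m.
      have := phimax (k, true); have := phimax (k, false).
      rewrite /phi /= -/m ler_norml => h1 h2; apply/andP; split; lra.
    have [uhM vM] := bx r rab.
    have uhm : `|uh r - v r| <= m.
      apply: row_norm_le; first exact: ltW.
      by move=> k; rewrite !mxE; apply: le_trans (uhP r rab k) (um k).
    rewrite /dphi /phi /= -/m [leRHS]mulrBr lerD2r.
    have -> : sgn e * (s * (u r ord0 j * g (uh r) ord0 j)
                   - s * (v r ord0 j * g (v r) ord0 j)) =
      s * (m * g (uh r) ord0 j) +
      (sgn e * s) * (v r ord0 j * (g (uh r) ord0 j - g (v r) ord0 j)).
      by rewrite /m; ring.
    clearbody m.
    apply: le_trans (ler_norm _) _; apply: le_trans (ler_normD _ _) _.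
    rewrite !normrM sgn1 s1 !mul1r (gtr0_norm m0) mulrDl lerD//.
      by rewrite mulrC ler_wpM2r ?gB// ltW.
    have /andP[v0 vjM] := vM j.
    rewrite (ger0_norm v0) -mulrA; apply: ler_pM => //.
    apply: le_trans (gL _ _ uhM vM j) _; by rewrite ler_wpM2l// ltW.
have := main (i, true) t tab; have := main (i, false) t tab.
by rewrite /phi /= ler_norml => ? ?; apply/andP; split; lra.
Qed.

(* Backwards in time the system is cooperative. *)
Lemma backward_monotone M : 0 < M -> forall (a b : R) u uh v,
  kolm_on (-1) a b u uh -> kolm_on (-1) a b v v ->
  (forall t, a <= t <= b -> box M (uh t) /\ box M (v t)) ->
  (forall t, a <= t <= b -> vle (uh t) (u t)) ->
  vle (u a) (v a) -> forall t, a <= t <= b -> vle (u t) (v t).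
Proof.
move=> M0 a b u uh v uP vP bx uhP uva t tab i.
have [B B0 gB] := g_bounded M0; have [L L0 gL] := g_lip M0.
pose phi i r := u r ord0 i - v r ord0 i.
pose dphi i r := (-1) * (u r ord0 i * g (uh r) ord0 i)
  - (-1) * (v r ord0 i * g (v r) ord0 i).
suff : forall i r, a <= r <= b -> phi i r <= 0.
  by move=> /(_ i t tab); rewrite subr_le0.
apply: (@max_principle R _ phi dphi (B + M * L) a b).
- move=> j r rab; have ? := uP r rab j; have ? := vP r rab j.
  exact: is_derive_eq.
- by move=> j; rewrite subr_le0.
- move=> j r rab phi0 phimax.
  have [uhM vM] := bx r rab.
  (* The comparison passes through the join of [uh r] and [v r]. Going from [uh r] up to [m] is
     settled by antitonicity; [m] is within [phi j r] of [v r] because [j] carries the largest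
     excess, so the Lipschitz bound applies there. *)
  pose m : 'rV[R]_d := \row_k Num.max (uh r ord0 k) (v r ord0 k).
  have mM : box M m.
    move=> k; rewrite mxE le_max ge_max.
    by have /andP[-> ->] := uhM k; have /andP[_ ->] := vM k.
  have mu : g m ord0 j <= g (uh r) ord0 j.
    apply: g_anti; first exact: box_orthant uhM.
    by move=> k; rewrite mxE le_max lexx.
  have mv : `|v r - m| <= phi j r.
    apply: row_norm_le; first exact: ltW.
    move=> k; rewrite !mxE distrC ger0_norm ?subr_ge0 ?le_max ?lexx ?orbT//.
    rewrite lerBlDr ge_max; apply/andP; split; last by rewrite lerDr ltW.
    have := phimax k; have := uhP r rab k; rewrite /phi => ? ?; lra.
  have gvm := le_trans (ler_norm _) (gL _ _ vM mM j).
  have gvm' : g (v r) ord0 j - g (uh r) ord0 j <= L * phi j r.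
    have : L * `|v r - m| <= L * phi j r by rewrite ler_wpM2l// ltW.
    lra.
  have /andP[v0 vjM] := vM j.
  have h1 : v r ord0 j * (g (v r) ord0 j - g (uh r) ord0 j) <= M * L * phi j r.
    apply: le_trans (ler_wpM2l v0 gvm') _.
    by rewrite -mulrA ler_wpM2r// mulr_ge0// ltW.
  have h2 : phi j r * (- g (uh r) ord0 j) <= B * phi j r.
    rewrite mulrC ler_wpM2r//; first exact: ltW.
    by apply: le_trans (ler_norm _) _; rewrite normrN gB.
  have -> : dphi j r = phi j r * (- g (uh r) ord0 j) +
     v r ord0 j * (g (v r) ord0 j - g (uh r) ord0 j) by rewrite /dphi /phi; ring.
  by lra.
Qed.

(** A coordinate [j] above [M] is above 1 even after truncation, so the point dominates the [j]-th
    basis vector, where the growth rate is 0; by antitonicity that coordinate cannot grow. *)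
Lemma forward_box M N x (w : R -> 'rV[R]_d) : 1 <= M -> M <= N -> box M x ->
  w 0 = 0 ->
  (forall t i, is_derive t (1 : R) (fun r => w r ord0 i)
      (1 * g (trunc N (scale_exp x (w t))) ord0 i)) ->
  forall t, 0 <= t -> box M (scale_exp x (w t)).
Proof.
move=> M1 MN xM w0 wP t t0 i.
have x0 := box_orthant xM.
have N0 : 0 <= N by lra.
rewrite scale_exp_ge0//=; rewrite -subr_le0.
pose phi i r := scale_exp x (w r) ord0 i - M.
pose dphi i r := scale_exp x (w r) ord0 i *
   (1 * g (trunc N (scale_exp x (w r))) ord0 i) - 0.
suff : forall i r, 0 <= r <= t -> phi i r <= 0 by move=> /(_ i t); apply; rewrite t0 /=.
apply: (@max_principle R _ phi dphi 0 0 t).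
- move=> j r _; have ? := @scale_exp_derive x w _ r j (wP r j).
  by apply: is_derive_eq.
- by move=> j; rewrite /phi w0 !mxE expR0 mulr1 subr_le0; case/andP: (xM j).
- move=> j r _ phi0 _; rewrite mul0r /dphi subr0 mul1r.
  rewrite mulr_ge0_le0//; first exact: scale_exp_ge0.
  rewrite -(g_axis j); apply: g_anti => [k|k]; rewrite !mxE ?eqxx/=.
    by case: (k == j).
  have [->|kj] := eqVneq k j.
    rewrite [leLHS](_ : _ = 1)// le_min; apply/andP; split; last lra.
    by move: phi0; rewrite /phi !mxE; lra.
  by rewrite le_min N0 mulr_ge0// expR_ge0.
Qed.

(** * Uniqueness, nonextendible solutions and the flow *)

Notation F := (time_one_map g).

(** Lipschitz constants exist only on boxes, so uniqueness first needs a box containing the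
    solution; continuity on a compact time interval provides it. *)
Lemma kolm_bounded s T u : 0 <= T -> kolm_on s 0 T u u ->
  (forall t, 0 <= t <= T -> orthant (u t)) ->
  exists2 M, 0 < M & forall t, 0 <= t <= T -> box M (u t).
Proof.
move=> T0 uP u0.
have [c cP] : {c : 'I_d -> R & forall i, 0 <= c i <= T /\
    forall t, 0 <= t <= T -> u t ord0 i <= u (c i) ord0 i}.
  apply: (@choice _ _ (fun i c => 0 <= c <= T /\
    forall t, 0 <= t <= T -> u t ord0 i <= u c ord0 i)) => i.
  have [|c cab cmax] := @EVT_max R (fun t => u t ord0 i) 0 T T0.
    apply: derivable_within_continuous => t /[!in_itv]/= tT.
    by have [] := uP t tT i.
  exists c; split; first by rewrite in_itv in cab.
  by move=> t tab; apply: cmax; rewrite in_itv.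
have c0 i : 0 <= u (c i) ord0 i by apply: u0; case: (cP i).
exists (1 + \sum_i u (c i) ord0 i) => [|t tT i].
  by rewrite ltr_pwDl// sumr_ge0.
rewrite u0//= (le_trans ((cP i).2 t tT))// (bigD1 i)//=.
have : 0 <= \sum_(j < d | j != i) u (c j) ord0 j by rewrite sumr_ge0.
by lra.
Qed.

Lemma kolm_uniq s T u v : `|s| = 1 -> 0 <= T -> kolm_on s 0 T u u -> kolm_on s 0 T v v ->
  (forall t, 0 <= t <= T -> orthant (u t) /\ orthant (v t)) -> u 0 = v 0 -> u T = v T.
Proof.
move=> s1 T0 uP vP o uv0.
have [M M0 uM] := kolm_bounded T0 uP (fun t tT => (o t tT).1).
have [N N0 vN] := kolm_bounded T0 vP (fun t tT => (o t tT).2).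
have [K K0 H] := gronwall (addr_gt0 M0 N0).
apply/rowP => i; apply/eqP; rewrite -subr_eq0 -normr_le0.
have := H s 0 T u u v s1 uP vP _ _ T _ i.
rewrite uv0 subrr normr0 mul0r; apply => //; last by rewrite T0 lexx.
move=> t tT; split.
  by apply: box_sub (uM t tT); rewrite lerDl ltW.
by apply: box_sub (vN t tT); rewrite lerDr ltW.
Qed.

Lemma kolm_rev s a b c u uh : kolm_on s a b u uh ->
  kolm_on (- s) (c - b) (c - a) (fun t => u (c - t)) (fun t => uh (c - t)).
Proof.
move=> uP t tab i; have := uP (c - t) ltac:(lra) i.
set f := fun r => u r ord0 i => ?.
rewrite (_ : (fun r => _) = (fun r => f (c - r)))//.
by apply: is_derive_eq; rewrite /GRing.scale/=; ring.
Qed.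

Lemma solution_kolm x J u a b : solution g x J u -> J a -> J b ->
  kolm_on 1 a b u u /\ forall t, a <= t <= b -> orthant (u t).
Proof.
move=> [_ iJ _ _ uP] Ja Jb; split=> t tab; have Jt := iJ _ _ Ja Jb _ tab.
  by move=> i; rewrite mul1r; exact: (uP t Jt).2.
exact: (uP t Jt).1.
Qed.

Lemma solution_uniq x J u J' v t : solution g x J u -> solution g x J' v ->
  J t -> J' t -> u t = v t.
Proof.
move=> us vs Jt J't.
have [_ _ J0 u0 _] := us; have [_ _ J'0 v0 _] := vs.
have uv0 : u 0 = v 0 by rewrite u0.
have [t0|/ltW t0] := leP 0 t.
  have [uP uo] := solution_kolm us J0 Jt; have [vP vo] := solution_kolm vs J'0 J't.
  by apply: (@kolm_uniq 1 t u v) => //; [rewrite normr1|move=> r rt; split; [apply: uo|apply: vo]].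
have [uP uo] := solution_kolm us Jt J0; have [vP vo] := solution_kolm vs J't J'0.
have := @kolm_uniq (-1) (0 - t) (fun r => u (0 - r)) (fun r => v (0 - r)).
rewrite !sub0r opprK oppr0; apply => //.
- by rewrite normrN normr1.
- by rewrite oppr_ge0.
- by have := @kolm_rev _ _ _ 0 _ _ uP; rewrite !sub0r oppr0.
- by have := @kolm_rev _ _ _ 0 _ _ vP; rewrite !sub0r oppr0.
- by move=> r rt; split; [apply: uo|apply: vo]; lra.
Qed.

(** Solutions through [x] agree at common times and their intervals all contain 0, so they glue to
    one solution on the union of those intervals, which is the maximal one. *)
Lemma nonextendible_exists x J u : solution g x J u ->
  exists J' v, nonextendible_solution g x J' v /\ J `<=` J'.
Proof.
move=> us.
pose Js : set R := [set t | exists I v, solution g x I v /\ I t].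
pose us_ t := xget (0 : 'rV[R]_d) [set y | exists I v, [/\ solution g x I v, I t & v t = y]].
have usE I v t : solution g x I v -> I t -> us_ t = v t.
  move=> vs It; apply: xget_unique; first by exists I, v.
  by move=> _ [I' [v' [vs' I't <-]]]; exact: solution_uniq vs' vs I't It.
have sub I v : solution g x I v -> I `<=` Js by move=> vs t It; exists I, v.
exists Js, us_; split; last exact: sub us.
split.
  have [oJ iJ J0 u0 uP] := us; split.
  - rewrite (_ : Js = \bigcup_(p in [set p | solution g x p.1 p.2]) p.1).
      by apply: bigcup_open => -[I v] [].
    apply/seteqP; split=> [t [I [v [vs It]]]|t [[I v] /= vs It]]; first by exists (I, v).
    by exists I, v.
  - move=> a b [I [v [vs Ia]]] [I' [v' [vs' I'b]]] c /andP[ac cb].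
    have [_ iI I0 _ _] := vs; have [_ iI' I'0 _ _] := vs'.
    have [c0|/ltW c0] := leP 0 c.
      by exists I', v'; split => //; apply: (iI' 0 b) => //; rewrite c0.
    by exists I, v; split => //; apply: (iI a 0) => //; rewrite ac.
  - by exists J, u.
  - by rewrite (usE J u).
  - move=> t [I [v [vs It]]]; have [oI _ _ _ vP] := vs.
    have [vo vd] := vP t It; rewrite (usE I v)//; split=> // i.
    apply: near_eq_is_derive (vd i).
    near=> r; rewrite (usE I v)//; near: r.
    exact: open_nbhs_nbhs.
move=> J' u' us' JJ' _; apply/seteqP; split => //; exact: sub us'.
Unshelve. all: by end_near. Qed.

Lemma flow_solution x J u t : solution g x J u -> J t -> flow g t x = u t.
Proof.
move=> us Jt; apply: xget_unique.
  have [J' [v [vn JJ']]] := nonextendible_exists us.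
  exists J', v; split; [exact: vn|exact: JJ'|].
  by apply: solution_uniq vn.1 us (JJ' _ Jt) Jt.
move=> _ [J' [v [[vs _] J't <-]]]; exact: solution_uniq vs us J't Jt.
Qed.

(** A [solution] lives on an open interval around 0, whereas [forward_box] speaks only of
    nonnegative times. Truncating at [M + 1] instead of [M] leaves room to run slightly
    backwards. *)
Lemma forward_trajectory M : 1 <= M -> exists2 B, 0 < B &
  forall x, box M x -> exists w : R -> 'rV[R]_d,
  [/\ w 0 = 0, forall t, 0 <= t -> box M (scale_exp x (w t)),
    forall (t : R) (i : 'I_d), 0 <= t ->
      is_derive t (1 : R) (fun r => w r ord0 i) (g (scale_exp x (w t)) ord0 i),
    forall (t : R) (i : 'I_d), `|w t ord0 i| <= B * `|t| &
    F x = scale_exp x (w 1)].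
Proof.
move=> M1; have N0 : 0 < M + 1 by lra.
have [B B0 H] := truncated_exists N0; exists B => // x xM.
have x0 := box_orthant xM.
have [w [w0 wP wB]] := H 1 x (normr1 _) x0.
have MN : M <= M + 1 by lra.
have wM := forward_box M1 MN xM w0 wP.
have wid t : 0 <= t -> trunc (M + 1) (scale_exp x (w t)) = scale_exp x (w t).
  by move=> t0; apply: trunc_id; apply: box_sub (wM t t0).
exists w; split => //.
  by move=> t i t0; have := wP t i; rewrite wid// mul1r.
(* Back to time [- dl] a coordinate grows at most by the factor [expR (B * dl) = 1 + M^-1], hence
   stays below [M * (1 + M^-1) = M + 1]. *)
pose dl := ln (1 + M^-1) / B.
have dl0 : 0 < dl.
  by rewrite divr_gt0// ln_gt0// ltrDl invr_gt0; lra.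
pose J : set R := [set t | - dl < t].
have Jid t : J t -> trunc (M + 1) (scale_exp x (w t)) = scale_exp x (w t).
  move=> Jt; have [/wid//|t0] := leP 0 t; apply: trunc_id => i.
  rewrite scale_exp_ge0//= mxE.
  have /andP[xi0 xiM] := xM i.
  have : expR (w t ord0 i) <= 1 + M^-1.
    rewrite -[leRHS]lnK ?ler_expR; last by rewrite posrE addr_gt0// invr_gt0; lra.
    apply: le_trans (ler_norm _) _; apply: le_trans (wB t i) _.
    rewrite mulrC -ler_pdivlMr// ltr0_norm// -/dl.
    by move: Jt; rewrite /J /=; lra.
  move=> e1; apply: le_trans (ler_pM xi0 (expR_ge0 _) xiM e1) _.
  by rewrite mulrDr mulr1 divff// gt_eqF//; lra.
have us : solution g x J (fun t => scale_exp x (w t)).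
  split.
  - exact: open_gt.
  - by move=> a b Ja Jb c /andP[ac cb]; apply: lt_le_trans Ja ac.
  - by rewrite /J /= oppr_lt0.
  - by apply/rowP => i; rewrite w0 !mxE expR0 mulr1.
  - move=> t Jt; split => [|i]; first exact: scale_exp_ge0.
    by apply: scale_exp_derive; have := wP t i; rewrite Jid// mul1r.
by apply: (flow_solution us); rewrite /J /=; lra.
Qed.

Lemma forward_kolm x (w : R -> 'rV[R]_d) T : 0 <= T -> (forall (t : R) (i : 'I_d), 0 <= t ->
      is_derive t (1 : R) (fun r => w r ord0 i) (g (scale_exp x (w t)) ord0 i)) ->
  kolm_on 1 0 T (fun t => scale_exp x (w t)) (fun t => scale_exp x (w t)).
Proof.
move=> T0 wP t /andP[t0 _] i; rewrite mul1r.
by apply: scale_exp_derive; exact: wP.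
Qed.

(** The path [u (1 - t)] solves the forward system from [u 1], and uniqueness identifies it with the
    trajectory defining [F]. This turns backward constructions into preimages under [F]. *)
Lemma backward_preimage u : kolm_on (-1) 0 1 u u ->
  (forall t, 0 <= t <= 1 -> orthant (u t)) -> F (u 1) = u 0.
Proof.
move=> uP uo.
have [M M1 uM] := orthant_box (uo 1 ltac:(lra)).
have [B B0 /(_ _ uM)[w [w0 wM wP _ ->]]] := forward_trajectory M1.
have := @kolm_uniq 1 1 (fun t => scale_exp (u 1) (w t)) (fun t => u (1 - t)).
rewrite subrr subr0; apply => //.
- by rewrite normr1.
- exact: forward_kolm.
- by have := @kolm_rev _ _ _ 1 _ _ uP; rewrite opprK subr0 subrr.
- move=> t t01; split; last by apply: uo; lra.
  by apply: (@box_orthant _ _ M); apply: wM; case/andP: t01.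
- by apply/rowP => i; rewrite !mxE w0 mxE expR0 mulr1.
Qed.

(** * The time-one map: bounds, preimages, comparison *)

Lemma time_one_orthant x : orthant x -> orthant (F x).
Proof.
move=> /[dup] x0 /orthant_box[M M1 xM].
have [B B0 /(_ _ xM)[w [_ _ _ _ ->]]] := forward_trajectory M1.
exact: scale_exp_ge0.
Qed.

Lemma time_one_bounds M : 1 <= M -> exists2 m, 0 < m & forall x, box M x ->
  forall i, m * x ord0 i <= F x ord0 i /\ m * F x ord0 i <= x ord0 i.
Proof.
move=> M1; have [B B0 H] := forward_trajectory M1.
exists (expR (- B)) => [|x xM i]; first exact: expR_gt0.
have [w [_ _ _ wB ->]] := H x xM.
have := wB 1 i; rewrite normr1 mulr1 mxE ler_norml => /andP[b1 b2].
have x0 : 0 <= x ord0 i by case/andP: (xM i).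
split; first by rewrite mulrC ler_wpM2l// ler_expR.
by rewrite mulrCA -expRD ler_piMr// -[leRHS]expR0 ler_expR; lra.
Qed.

Lemma time_one_lipschitz M : 1 <= M -> exists2 K, 0 < K & forall x y,
  box M x -> box M y -> `|F x - F y| <= K * `|x - y|.
Proof.
move=> M1; have [B B0 H] := forward_trajectory M1.
have [K K0 G] := gronwall (lt_le_trans ltr01 M1).
exists (expR K) => [|x y xM yM]; first exact: expR_gt0.
have [w [w0 wM wP _ ->]] := H x xM.
have [z [z0 zM zP _ ->]] := H y yM.
apply: row_norm_le => [|i]; first by rewrite mulr_ge0// expR_ge0.
have := G 1 0 1 (fun t => scale_exp x (w t)) (fun t => scale_exp x (w t))
  (fun t => scale_exp y (z t)) (normr1 _) (forward_kolm ler01 wP) (forward_kolm ler01 zP).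
rewrite w0 z0 => /(_ _ _ 1 _ i); rewrite subr0 mulr1.
have e0 (v : 'rV[R]_d) : scale_exp v 0 = v.
  by apply/rowP => j; rewrite !mxE expR0 mulr1.
rewrite !e0 mulrC !mxE; apply => //; last by rewrite ler01 lexx.
by move=> t /andP[t0 _]; split; [apply: wM|apply: zM].
Qed.

Lemma scale_exp0 x : scale_exp x 0 = x.
Proof. by apply/rowP => i; rewrite !mxE expR0 mulr1. Qed.

Lemma reversed_trajectory x (w : R -> 'rV[R]_d) :
  (forall (t : R) (i : 'I_d), 0 <= t ->
      is_derive t (1 : R) (fun r => w r ord0 i) (g (scale_exp x (w t)) ord0 i)) ->
  kolm_on (-1) 0 1 (fun t => scale_exp x (w (1 - t))) (fun t => scale_exp x (w (1 - t))).
Proof.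
move=> wP; have := @kolm_rev _ _ _ 1 _ _ (forward_kolm ler01 wP).
by rewrite subrr subr0.
Qed.

(** The order is given at time 1, which is where the reversed trajectories start;
    [backward_monotone] carries it to all earlier times. *)
Lemma time_one_vle_trajectory x y (w z : R -> 'rV[R]_d) M : 1 <= M ->
  (forall (t : R) (i : 'I_d), 0 <= t ->
    is_derive t (1 : R) (fun r => w r ord0 i) (g (scale_exp x (w t)) ord0 i)) ->
  (forall (t : R) (i : 'I_d), 0 <= t ->
    is_derive t (1 : R) (fun r => z r ord0 i) (g (scale_exp y (z t)) ord0 i)) ->
  (forall t, 0 <= t -> box M (scale_exp x (w t)) /\ box M (scale_exp y (z t))) ->
  vle (scale_exp x (w 1)) (scale_exp y (z 1)) ->
  forall t, 0 <= t <= 1 -> vle (scale_exp x (w t)) (scale_exp y (z t)).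
Proof.
move=> M1 wP zP bx w1 t t01.
have := backward_monotone (lt_le_trans ltr01 M1)
  (reversed_trajectory wP) (reversed_trajectory zP) _ _ _ (t := 1 - t).
rewrite subr0 subKr; apply => //; last by lra.
by move=> r /andP[r0 r1]; apply: bx; lra.
by move=> r _ i.
Qed.

(** The truncated backward solution from [z] always exists, and comparison keeps it below the
    trajectory of [y]. So it stays where the truncation is inactive and solves the true system. *)
Lemma time_one_preimage_below y z : orthant y -> orthant z -> vle z (F y) ->
  exists2 x, orthant x & F x = z.
Proof.
move=> y0 z0 zy; have [M M1 yM] := orthant_box y0.
have M0 : 0 < M by lra.
have [B B0 /(_ _ yM)[w [w0 wM wP _ Fy]]] := forward_trajectory M1.
have [B' B'0 H] := truncated_exists M0.
have [|p [p0 pP _]] := H (-1) z _ z0; first by rewrite normrN normr1.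
pose u t := scale_exp z (p t).
have u0 t : orthant (u t) by apply: scale_exp_ge0.
have uP : kolm_on (-1) 0 1 u (fun t => trunc M (u t)).
  move=> t _ i; rewrite mulrCA; apply: scale_exp_derive; exact: pP.
have uw : forall t, 0 <= t <= 1 -> vle (u t) (scale_exp y (w (1 - t))).
  apply: (backward_monotone M0 uP (reversed_trajectory wP)).
  - move=> t t01; split; first by apply: trunc_box => //; exact: ltW.
    by apply: wM; lra.
  - by move=> t _ i; rewrite mxE ge_min lexx.
  - by rewrite /u p0 scale_exp0 subr0 -Fy.
exists (u 1) => //; rewrite backward_preimage// /u ?p0 ?scale_exp0//.
move=> t t01 i; have := uP t t01 i; rewrite trunc_id//.
by apply: box_vle (uw t t01) _ => //; apply: wM; lra.
Qed.

(** A truncated backward solution from [z] stays close to the trajectory of [y], which lies in a box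
    of side [M]; being within 1 of it, it never reaches the cut-off at [M + 1]. *)
Lemma time_one_open y e : orthant y -> 0 < e -> exists2 dl, 0 < dl &
  forall z, orthant z -> `|z - F y| < dl ->
  exists x, [/\ orthant x, F x = z & `|x - y| < e].
Proof.
move=> y0 e0; have [M M1 yM] := orthant_box y0.
have N0 : 0 < M + 1 by lra.
have [B B0 /(_ _ yM)[w [w0 wM wP _ Fy]]] := forward_trajectory M1.
have [B' B'0 H] := truncated_exists N0.
have [K K0 G] := gronwall N0.
pose m := Num.min 1 (e / 2).
have m0 : 0 < m by rewrite lt_min ltr01 divr_gt0.
have m1 : m <= 1 by rewrite ge_min lexx.
have me : m <= e / 2 by rewrite ge_min lexx orbT.
(* The factor [expR (- K)] compensates the Gronwall growth over one unit of time, so the distance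
   remains at most [m]. *)
exists (m * expR (- K)) => [|z z0 zFy]; first by rewrite mulr_gt0// expR_gt0.
have [|p [p0 pP _]] := H (-1) z _ z0; first by rewrite normrN normr1.
pose u t := scale_exp z (p t).
have u0 t : orthant (u t) by apply: scale_exp_ge0.
have uP : kolm_on (-1) 0 1 u (fun t => trunc (M + 1) (u t)).
  move=> t _ i; rewrite mulrCA; apply: scale_exp_derive; exact: pP.
have wN t : 0 <= t <= 1 -> box (M + 1) (scale_exp y (w (1 - t))).
  by move=> t01; apply: (@box_sub _ _ M); [lra|apply: wM; lra].
have uw t : 0 <= t <= 1 -> forall i,
    `|u t ord0 i - scale_exp y (w (1 - t)) ord0 i| <= m.
  move=> t01 i.
  have uN r : 0 <= r <= 1 -> box (M + 1) (trunc (M + 1) (u r)) /\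
      box (M + 1) (scale_exp y (w (1 - r))).
    by move=> r01; split; [apply: trunc_box => //; exact: ltW|exact: wN].
  apply: le_trans (G _ _ _ _ _ _ _ uP (reversed_trajectory wP) uN _ t t01 i) _.
  - by rewrite normrN normr1.
  - move=> r r01 j; rewrite mxE; apply: min_dist.
    by have /andP[] := wN r r01 j.
  - rewrite /u p0 scale_exp0 !subr0 -Fy.
    have Kt : expR (K * t) <= expR K by rewrite ler_expR ler_piMr//; case/andP: t01.
    apply: le_trans (ler_pM _ _ (ltW zFy) Kt) _; rewrite ?expR_ge0//.
    by rewrite -mulrA -expRD addNr expR0 mulr1.
exists (u 1); split => //.
  rewrite backward_preimage// /u ?p0 ?scale_exp0//.
  move=> t t01 i; have := uP t t01 i; rewrite trunc_id// => j.
  rewrite u0/=; have := uw t t01 j; rewrite ler_norml => /andP[_].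
  have /andP[_] := wM (1 - t) ltac:(lra) j; lra.
apply: (@le_lt_trans _ _ m); last by lra.
apply: row_norm_le => [|i]; first exact: ltW.
by have := uw 1 ltac:(lra) i; rewrite subrr w0 scale_exp0 !mxE.
Qed.

Lemma time_one_axis i : F (delta_mx ord0 i) = delta_mx ord0 i.
Proof.
have us : solution g (delta_mx ord0 i) setT (fun=> delta_mx ord0 i).
  split => // [|t _]; first exact: openT.
  split => [j|j]; first by rewrite mxE; case: (_ && _).
  rewrite mxE eqxx/=; have [->|ji] := eqVneq j i.
    by rewrite g_axis mulr0; exact: is_derive_cst.
  by rewrite mul0r; exact: is_derive_cst.
exact: flow_solution us _.
Qed.

Lemma time_one_retrotone_weak x y : orthant x -> orthant y -> vle (F x) (F y) ->
  vle x y.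
Proof.
move=> /orthant_box[M M1 xM] /orthant_box[N N1 yN] xy.
have MN1 : 1 <= M + N by lra.
have [B B0 H] := forward_trajectory MN1.
have [|w [w0 wM wP _ Fx]] := H x; first by apply: box_sub xM; lra.
have [|z [z0 zM zP _ Fy]] := H y; first by apply: box_sub yN; lra.
have := time_one_vle_trajectory MN1 wP zP _ _ (t := 0).
rewrite w0 z0 !scale_exp0; apply; last by lra.
  by move=> t t0; split; [apply: wM|apply: zM].
by rewrite -Fx -Fy.
Qed.

(** In ratios the conclusion says that x_i / y_i, multiplied by 1 + c (F_j y - F_j x), is at most
    F_i x / F_i y. Here [p i] is the logarithm of the gain of the ratio; its derivative is bounded
    below by the gap in coordinate [j], and 1 + s <= exp s gives the final form. *)
Lemma time_one_retrotone (cpl : rel 'I_d) M : 1 <= M ->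
  (exists2 c, 0 < c & forall x y, box M x -> box M y -> vle x y ->
     forall i j, cpl i j -> c * (y ord0 j - x ord0 j) <= g x ord0 i - g y ord0 i) ->
  exists2 c, 0 < c & forall x y, box M x -> box M y -> vle (F x) (F y) ->
  forall i j, cpl i j ->
    x ord0 i * F y ord0 i * (1 + c * (F y ord0 j - F x ord0 j)) <=
    y ord0 i * F x ord0 i.
Proof.
move=> M1 [c c0 gc]; have [B B0 H] := forward_trajectory M1.
have [B' B'0 gB] := g_bounded (lt_le_trans ltr01 M1).
exists (c * expR (- B')) => [|x y xM yM xy i j ij].
  by rewrite mulr_gt0// expR_gt0.
have [w [w0 wM wP _ Fx]] := H x xM.
have [z [z0 zM zP _ Fy]] := H y yM.
have uv : forall t, 0 <= t <= 1 -> vle (scale_exp x (w t)) (scale_exp y (z t)).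
  apply: (time_one_vle_trajectory M1 wP zP).
    by move=> t t0; split; [apply: wM|apply: zM].
  by rewrite -Fx -Fy.
pose p (k : 'I_d) (t : R) := w t ord0 k - z t ord0 k.
have pz k t : expR (w t ord0 k) = expR (z t ord0 k) * expR (p k t).
  by rewrite -expRD /p addrC subrK.
have pP k (t : R) : 0 <= t -> is_derive t (1 : R) (p k)
    (g (scale_exp x (w t)) ord0 k - g (scale_exp y (z t)) ord0 k).
  by move=> t0; have ? := wP t k t0; have ? := zP t k t0; exact: is_derive_eq.
have p1 k t : 0 <= t <= 1 -> p k t <= p k 1.
  move=> /andP[t0 t1]; apply: (@ge0_derive_le _ (p k) (fun t =>
    g (scale_exp x (w t)) ord0 k - g (scale_exp y (z t)) ord0 k) t 1 t1) => r rt.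
    by apply: pP; lra.
  rewrite subr_ge0; apply: g_anti; last by apply: uv; lra.
  by apply: (@box_orthant _ _ M); apply: wM; lra.
have z1 k t : 0 <= t <= 1 -> - B' + z 1 ord0 k <= z t ord0 k.
  move=> /andP[t0 t1].
  have : z 1 ord0 k - B' * 1 <= z t ord0 k - B' * t.
    rewrite -lerN2.
    apply: (@ge0_derive_le _ (fun r => - (z r ord0 k - B' * r))
      (fun r => - (g (scale_exp y (z r)) ord0 k - B')) t 1 t1) => r rt.
      have ? := zP r k ltac:(lra); apply: is_derive_eq.
      by rewrite /GRing.scale/=; ring.
    rewrite oppr_ge0 subr_le0; apply: le_trans (ler_norm _) _; apply: gB.
    by apply: zM; lra.
  have : 0 <= B' * t by rewrite mulr_ge0// ltW.
  lra.
have D0 : 0 <= F y ord0 j - F x ord0 j by rewrite subr_ge0.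
have x0 : 0 <= x ord0 j by case/andP: (xM j).
(* The gap at time [t] is bounded below by the gap at time 1: factoring out [expR (z t ord0 j)]
   leaves a quantity that decreases in time because [p j] increases, and the factor itself grows at
   most by [expR B'] up to time 1. *)
have diff t : 0 <= t <= 1 -> expR (- B') * (F y ord0 j - F x ord0 j) <=
    scale_exp y (z t) ord0 j - scale_exp x (w t) ord0 j.
  move=> t01.
  have -> : F y ord0 j - F x ord0 j =
     expR (z 1 ord0 j) * (y ord0 j - x ord0 j * expR (p j 1)).
    by rewrite Fx Fy !mxE pz; ring.
  have E0 : 0 <= y ord0 j - x ord0 j * expR (p j 1).
    rewrite -(pmulr_rge0 _ (expR_gt0 (z 1 ord0 j))).
    by move: D0; rewrite Fx Fy !mxE pz; lra.
  rewrite mulrA -expRD.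
  apply: le_trans (ler_wpM2r E0 (_ : _ <= expR (z t ord0 j))) _.
    by rewrite ler_expR z1.
  have -> : scale_exp y (z t) ord0 j - scale_exp x (w t) ord0 j =
     expR (z t ord0 j) * (y ord0 j - x ord0 j * expR (p j t)).
    by rewrite !mxE pz; ring.
  rewrite ler_wpM2l ?expR_ge0// lerD2l lerN2 ler_wpM2l// ler_expR.
  exact: p1.
set D := c * expR (- B') * (F y ord0 j - F x ord0 j).
have pi1 : D <= p i 1.
  have : p i 0 - D * 0 <= p i 1 - D * 1.
    apply: (@ge0_derive_le _ (fun r => p i r - D * r) (fun r =>
      g (scale_exp x (w r)) ord0 i - g (scale_exp y (z r)) ord0 i - D) 0 1 ler01) => r rt.
      have ? := pP i r ltac:(lra); apply: is_derive_eq.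
      by rewrite /GRing.scale/=; ring.
    rewrite subr_ge0 /D -mulrA.
    apply: le_trans (gc _ _ (wM r _) (zM r _) (uv r rt) i j ij); try lra.
    by rewrite ler_wpM2l ?(ltW c0)// diff.
  by rewrite /p w0 z0 !mxE; lra.
have -> : y ord0 i * F x ord0 i = x ord0 i * F y ord0 i * expR (p i 1).
  by rewrite Fx Fy !mxE pz; ring.
rewrite ler_wpM2l//.
  have /andP[y0 _] := yM i; have /andP[xi0 _] := xM i.
  by rewrite Fy mxE !mulr_ge0// expR_ge0.
by apply: le_trans (expR_ge1Dx _) _; rewrite ler_expR.
Qed.

Lemma time_one_repelling c : 0 < c -> (forall i, c <= g 0 ord0 i) ->
  exists dl q, [/\ 0 < dl, dl <= 1, 1 < q & forall x, box dl x -> forall i,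
    q * x ord0 i <= F x ord0 i].
Proof.
move=> c0 gc.
have [L L0 gL] := g_lip (ltr01 : 0 < (1 : R)).
have [B B0 H] := forward_trajectory (lexx (1 : R)).
(* Over unit time coordinates grow at most by [expR B], so the trajectory stays within [c / (2 * L)]
   of 0, where growth rates differ from those at 0 by at most [c / 2]. *)
pose dl := Num.min 1 (c / (2 * L)) * expR (- B).
have e1 : expR (- B) <= 1 by rewrite -expR0 ler_expR; lra.
have m0 : 0 < Num.min 1 (c / (2 * L)) by rewrite lt_min ltr01 divr_gt0// mulr_gt0.
have m1 : Num.min 1 (c / (2 * L)) <= 1 by rewrite ge_min lexx.
have mc : Num.min 1 (c / (2 * L)) <= c / (2 * L) by rewrite ge_min lexx orbT.
have dl1 : dl <= 1.
  by apply: le_trans m1; rewrite ler_piMr// ltW.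
exists dl, (1 + c / 2); split => //; first by rewrite mulr_gt0// expR_gt0.
- by rewrite ltrDl divr_gt0.
move=> x xdl i; have x1 : box 1 x by apply: box_sub xdl.
have [w [w0 wM wP wB ->]] := H x x1.
have gt t : 0 <= t <= 1 -> c / 2 <= g (scale_exp x (w t)) ord0 i.
  move=> /andP[t0 t1].
  have um : `|scale_exp x (w t)| <= c / (2 * L).
    apply: row_norm_le => [|k]; first by rewrite divr_ge0 ?mulr_ge0// ltW.
    apply: le_trans mc; have /andP[xk0 xk] := xdl k.
    rewrite mxE ger0_norm; last by rewrite mulr_ge0// expR_ge0.
    have wk : w t ord0 k <= B.
      apply: le_trans (ler_norm _) _; apply: le_trans (wB t k) _.
      by rewrite ger0_norm// ler_piMr// ltW.
    apply: le_trans (ler_pM xk0 (expR_ge0 _) xk (_ : _ <= expR B)) _.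
      by rewrite ler_expR.
    by rewrite /dl -mulrA -expRD addNr expR0 mulr1.
  have b0 : box 1 (0 : 'rV[R]_d) by move=> k; rewrite mxE lexx ler01.
  have := gL _ _ (wM t t0) b0 i; rewrite subr0 ler_norml => /andP[h _].
  have h2 : L * `|scale_exp x (w t)| <= L * (c / (2 * L)).
    by rewrite ler_wpM2l// ltW.
  have h3 : L * (c / (2 * L)) = c / 2 by field; rewrite gt_eqF.
  by have := gc i; lra.
have wi : c / 2 <= w 1 ord0 i.
  have : w 0 ord0 i - c / 2 * 0 <= w 1 ord0 i - c / 2 * 1.
    apply: (@ge0_derive_le _ (fun r => w r ord0 i - c / 2 * r)
      (fun r => g (scale_exp x (w r)) ord0 i - c / 2) 0 1 ler01) => r rt.
      have ? := wP r i ltac:(lra); apply: is_derive_eq.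
      by rewrite /GRing.scale/=; ring.
    by rewrite subr_ge0 gt.
  by rewrite w0 mxE; lra.
rewrite mxE mulrC ler_wpM2l//; first by case/andP: (x1 i).
by apply: le_trans (expR_ge1Dx _) _; rewrite ler_expR.
Qed.

End Kolmogorov.


(** * Growth rates of class C1 *)

Section C1.
Context {R : realType} {d : nat}.
Variables (g G : 'rV[R]_d -> 'rV[R]_d) (U : set 'rV[R]_d).
Implicit Types (x y v : 'rV[R]_d) (M : R).
Hypothesis g_C1 : C1_extension g U G.

Lemma box_compact M : compact (box M : set 'rV[R]_d).
Proof.
have := @rV_compact R d (fun=> `[0, M]%classic) (fun=> @segment_compact R 0 M).
by under eq_set do rewrite /= ; apply.
Qed.

Lemma norm_between (a b c : R) : a <= c -> c <= b -> `|c| <= `|b| + `|a|.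
Proof.
move=> ac cb; rewrite ler_norml.
have := ler_norm b; have := ler_norm (- a); rewrite normrN.
have := normr_ge0 a; have := normr_ge0 b.
by move=> ? ? ? ?; apply/andP; split; lra.
Qed.

(** Makes a finite family of pointwise margins uniform. The default 1 of the minimum covers an empty
    index type, as when [d] is 0. *)
Lemma min_exists_pos (I : finType) (P : I -> R -> Prop) :
  (forall i a b, a <= b -> P i b -> P i a) -> (forall i, exists2 c, 0 < c & P i c) ->
  exists2 c, 0 < c & forall i, P i c.
Proof.
move=> Pmono Pex.
have [c cP] : {c : I -> R & forall i, 0 < c i /\ P i (c i)}.
  by apply: (@choice _ _ (fun i c => 0 < c /\ P i c)) => i; have [c] := Pex i; exists c.
exists (\big[Num.min/1]_i c i) => [|i].
  by apply: lt_bigmin => // i _; exact: (cP i).1.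
by apply: Pmono (cP i).2; exact: bigmin_le.
Qed.

Lemma derive_along_line x v s i : differentiable G (x + s *: v) ->
  is_derive s (1 : R) (fun r => G (x + r *: v) ord0 i)
    (\sum_j v ord0 j * deriv_mx G (x + s *: v) i j).
Proof.
set p := x + s *: v => dG.
have cv : (h^-1 *: (G (h *: v + p) - G p)) ord0 i @[h --> 0^'] --> ('D_v G p) ord0 i.
  have dv : h^-1 *: (G (h *: v + p) - G p) @[h --> 0^'] --> 'D_v G p.
    exact: (@diff_derivable _ _ _ G p v dG).
  exact: cvg_comp dv (@coord_continuous R 1 d ord0 i _).
have lineE : (fun h => h^-1 *: (((fun r => G (x + r *: v) ord0 i) \o shift s) (h *: (1 : R))
     - G (x + s *: v) ord0 i)) = (fun h => (h^-1 *: (G (h *: v + p) - G p)) ord0 i).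
  apply/funext => h; rewrite !mxE /= /shift /= /GRing.scale/= mulr1.
  by rewrite (_ : x + (h + s) *: v = h *: v + p)// /p scalerDl addrCA.
have DE : ('D_v G p) ord0 i = \sum_j v ord0 j * deriv_mx G p i j.
  by rewrite deriveEjacobian// mxE; apply: eq_bigr => j _; rewrite !mxE.
apply: DeriveDef; first by rewrite /derivable lineE; apply: cvgP cv.
by rewrite /derive lineE -DE; apply: cvg_lim cv.
Qed.

Lemma mean_value x y i : orthant x -> orthant y -> exists s, 0 <= s <= 1 /\
  g y ord0 i - g x ord0 i =
  \sum_j (y ord0 j - x ord0 j) * deriv_mx G (x + s *: (y - x)) i j.
Proof.
move=> x0 y0; have [oU OU Gg dG] := g_C1.
have seg s : 0 <= s <= 1 -> orthant (x + s *: (y - x)).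
  move=> s01 j; rewrite !mxE.
  have -> : x ord0 j + s * (y ord0 j - x ord0 j) =
    (1 - s) * x ord0 j + s * y ord0 j by ring.
  by have := x0 j; have := y0 j; rewrite addr_ge0 ?mulr_ge0//; lra.
pose f (s : R) : R := G (x + s *: (y - x)) ord0 i.
pose df s := \sum_j (y - x) ord0 j * deriv_mx G (x + s *: (y - x)) i j.
have fP (s : R) : 0 <= s <= 1 -> is_derive s (1 : R) f (df s).
  by move=> s01; apply: derive_along_line; apply: (dG _ _).1; apply/OU/seg.
have [||c c01] := @MVT_segment R f df 0 1 ler01.
- by move=> s /[!in_itv]/= /andP[? ?]; apply: fP; rewrite !ltW.
- apply: derivable_within_continuous => s /[!in_itv]/= s01.
  by have [] := fP s s01.
rewrite subr0 mulr1 /f scale0r addr0 scale1r (addrC x) subrK !Gg// => ->.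
by exists c; split; [rewrite in_itv in c01|apply: eq_bigr => j _; rewrite !mxE].
Qed.

Lemma deriv_mx_continuous M i j : {within box M, continuous (fun x => deriv_mx G x i j)}.
Proof.
have [oU OU _ dG] := g_C1.
apply: continuous_in_subspaceT => x /set_mem xM.
apply: (@continuous_comp _ _ _ (deriv_mx G) (fun A : 'M[R]_d => A i j)).
  by apply: (dG x _).2; apply/OU/box_orthant/xM.
exact: coord_continuous.
Qed.

Lemma box_segment M x y s : box M x -> box M y -> 0 <= s <= 1 ->
  box M (x + s *: (y - x)).
Proof.
move=> xM yM s01 j; have /andP[x0 x1] := xM j; have /andP[y0 y1] := yM j.
rewrite !mxE.
have -> : x ord0 j + s * (y ord0 j - x ord0 j) =
  (1 - s) * x ord0 j + s * y ord0 j by ring.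
by rewrite addr_ge0 ?mulr_ge0//=; nra.
Qed.

Lemma C1_lipschitz M : 0 < M -> exists2 L, 0 < L &
  forall x y, box M x -> box M y ->
  forall i, `|g x ord0 i - g y ord0 i| <= L * `|x - y|.
Proof.
move=> M0; have b0 : (box M : set 'rV[R]_d) !=set0.
  by exists (0 : 'rV[R]_d) => i; rewrite mxE lexx ltW.
have [c cP] : {c : 'I_d * 'I_d -> R & forall p x, box M x ->
    `|deriv_mx G x p.1 p.2| <= c p}.
  apply: (@choice _ _ (fun p c => forall x, box M x -> `|deriv_mx G x p.1 p.2| <= c)).
  move=> [i j] /=.
  have [a _ aP] := compact_EVT_max b0 (@box_compact M) (@deriv_mx_continuous M i j).
  have [b _ bP] := compact_EVT_min b0 (@box_compact M) (@deriv_mx_continuous M i j).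
  exists (`|deriv_mx G a i j| + `|deriv_mx G b i j|) => x xM.
  exact: norm_between (bP x (mem_set xM)) (aP x (mem_set xM)).
have c0 p : 0 <= c p by have [x xM] := b0; apply: le_trans (cP p x xM).
exists (1 + \sum_i \sum_j c (i, j)) => [|x y xM yM i].
  by rewrite ltr_pwDl// sumr_ge0// => i _; rewrite sumr_ge0.
have [s [s01 ->]] := mean_value i (box_orthant yM) (box_orthant xM).
apply: le_trans (ler_norm_sum _ _ _) _.
apply: (@le_trans _ _ (\sum_j c (i, j) * `|x - y|)).
  apply: ler_sum => j _; rewrite normrM mulrC; apply: ler_pM => //.
    by apply: (cP (i, j)); apply: box_segment.
  by have := coord_le_norm (x - y) j; rewrite !mxE.
rewrite -mulr_suml ler_wpM2r// [leRHS](_ : _ = 1 + (\sum_j c (i, j) +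
  \sum_(k < d | k != i) \sum_j c (k, j))); last by rewrite (bigD1 i).
have : 0 <= \sum_(k < d | k != i) \sum_j c (k, j).
  by rewrite sumr_ge0// => k _; rewrite sumr_ge0.
by lra.
Qed.

Hypothesis Dg_le0 : forall x, orthant x -> forall i j, deriv_mx G x i j <= 0.

Lemma C1_antitone x y : orthant x -> vle x y -> forall i, g y ord0 i <= g x ord0 i.
Proof.
move=> x0 xy i; have y0 : orthant y by move=> j; apply: le_trans (xy j).
have [s [s01 e]] := mean_value i x0 y0.
rewrite -subr_le0 e; apply: sumr_le0 => j _; rewrite mulr_ge0_le0 ?subr_ge0//.
apply: Dg_le0 => k; rewrite !mxE addr_ge0// mulr_ge0 ?subr_ge0//.
by case/andP: s01.
Qed.

(** On the compact box the entries selected by [cpl] are bounded away from 0. In the mean value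
    formula all other terms have the favourable sign and are dropped. *)
Lemma C1_strict (cpl : rel 'I_d) M : 0 < M ->
  (forall x, orthant x -> forall i j, cpl i j -> deriv_mx G x i j < 0) ->
  exists2 c, 0 < c & forall x y, box M x -> box M y -> vle x y ->
     forall i j, cpl i j -> c * (y ord0 j - x ord0 j) <= g x ord0 i - g y ord0 i.
Proof.
move=> M0 D0; have b0 : (box M : set 'rV[R]_d) !=set0.
  by exists (0 : 'rV[R]_d) => i; rewrite mxE lexx ltW.
have [||c c0 cP] := @min_exists_pos ('I_d * 'I_d)%type (fun p c =>
  forall x, box M x -> cpl p.1 p.2 -> deriv_mx G x p.1 p.2 <= - c).
- by move=> p a b ab H x xM /(H x xM); lra.
- move=> [i j] /=.
  have [a aM aP] := compact_EVT_max b0 (@box_compact M) (@deriv_mx_continuous M i j).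
  have [ij|ij] := boolP (cpl i j); last by exists 1.
  exists (- deriv_mx G a i j) => [|x xM _].
    by rewrite oppr_gt0 D0//; apply: box_orthant; apply: set_mem aM.
  by rewrite opprK; apply: aP; apply: mem_set.
exists c => // x y xM yM xy i j ij.
have [s [s01 e]] := mean_value i (box_orthant xM) (box_orthant yM).
have bs : box M (x + s *: (y - x)) by apply: box_segment.
rewrite -lerN2 opprB e (bigD1 j)//=.
set S := \sum_(k < d | _) _.
have S0 : S <= 0.
  apply: sumr_le0 => k _; rewrite mulr_ge0_le0 ?subr_ge0//.
  by apply: Dg_le0; apply: box_orthant bs.
have := cP (i, j) _ bs ij; rewrite /=.
move: (deriv_mx _ _ _ _) S S0 => D S S0 Dc.
have := xy j; move: (x ord0 j) (y ord0 j) => a b ab.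
have ab0 : 0 <= b - a by rewrite subr_ge0.
by have := ler_wpM2l ab0 Dc; lra.
Qed.

End C1.

(** * Maximal invariant sets *)

Section Topology.
Context {R : realType} {d : nat}.
Implicit Types (K A B : set 'rV[R]_d) (f h : 'rV[R]_d -> 'rV[R]_d) (x y z : 'rV[R]_d).

Lemma row_compact_closed A : compact A -> closed A.
Proof. by apply: compact_closed; exact: norm_hausdorff. Qed.

(** Closed subsets of [K] are compact, so [f] maps them to closed sets, which are the preimages
    under [h]. *)
Lemma compact_inverse_continuous K f h : compact K -> {within K, continuous f} ->
  (forall x, K x -> h (f x) = x) -> {within f @` K, continuous h}.
Proof.
move=> cK fK hf; apply/continuous_closedP => C cC; apply/closed_subspaceP.
exists (f @` (K `&` C)).
  have cKC : compact (K `&` C) by exact: compact_closedI.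
  apply: row_compact_closed; refine (continuous_compact _ cKC).
  by apply: continuous_subspaceW fK; exact: subIsetl.
apply/seteqP; split=> y /= [].
  by move=> [x [Kx Cx] <-] _; split; [change (C (h (f x))); rewrite hf|exists x].
by move=> Cy [x Kx xy]; have : C (h y) := Cy; rewrite -xy hf// => Cx; split; exists x.
Qed.

Lemma cluster_sequence K (x : nat -> 'rV[R]_d) : compact K -> (forall n, K (x n)) ->
  exists2 z, K z & forall e, 0 < e -> forall N, exists2 n, (N <= n)%N & `|x n - z| < e.
Proof.
move=> cK xK.
have [|z [Kz zx]] := cK (x @ \oo) _; first by exists 0%N => // n _ /=; exact: xK.
exists z => // e e0 N.
have [|_ [[n Nn <-]]] := zx (x @` [set n | (N <= n)%N]) (ball z e) _ (nbhsx_ballx _ _ e0).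
  by exists N => // n Nn; exists n.
by rewrite -ball_normE /ball_/= distrC => ?; exists n.
Qed.

Lemma lipschitz_within K f (C : R) : (forall x y, K x -> K y -> `|f x - f y| <= C * `|x - y|) ->
  {within K, continuous f}.
Proof.
move=> fC; apply/subspace_continuousP => x Kx.
apply/cvgrPdist_lt => e e0.
have d0 : 0 < e / (`|C| + 1) by rewrite divr_gt0// ltr_wpDl.
have nd : nbhs x [set y | `|x - y| < e / (`|C| + 1)].
  by have := nbhsx_ballx x _ d0; rewrite -ball_normE.
near=> y.
have Ky : K y by near: y; exact: withinT.
apply: le_lt_trans (fC _ _ Kx Ky) _.
have : `|x - y| < e / (`|C| + 1).
  by near: y; apply: cvg_within; exact: nd.
rewrite ltr_pdivlMr ?ltr_wpDl//.
have : C * `|x - y| <= `|C| * `|x - y| by rewrite ler_wpM2r// ler_norm.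
have := normr_ge0 (x - y).
by lra.
Unshelve. all: by end_near. Qed.

Lemma eventually_all (I : finType) (P : I -> nat -> Prop) :
  (forall i, exists N, forall n, (N <= n)%N -> P i n) ->
  exists N, forall n, (N <= n)%N -> forall i, P i n.
Proof.
move=> Pex; have [N NP] := @choice _ _ (fun i N => forall n, (N <= n)%N -> P i n) Pex.
exists (\max_i N i)%N => n Nn i; apply: NP; apply: leq_trans Nn; exact: leq_bigmax.
Qed.

Lemma closed_adherent A z : closed A ->
  (forall e, 0 < e -> exists2 y, A y & `|y - z| < e) -> A z.
Proof.
move=> cA Az; apply: cA => B /nbhs_ballP[e /= e0 eB].
have [y Ay yz] := Az e e0; exists y; split => //; apply: eB.
by rewrite -ball_normE /ball_/= distrC.
Qed.

Lemma adherent_closed A :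
  (forall z, (forall e, 0 < e -> exists2 y, A y & `|y - z| < e) -> A z) -> closed A.
Proof.
move=> Az z zA; apply: Az => e e0.
have [y [Ay yz]] := zA (ball z e) (nbhsx_ballx _ _ e0).
by exists y => //; move: yz; rewrite -ball_normE /ball_/= distrC.
Qed.

Lemma monotone_increments (a : nat -> R) (b : R) : (forall n, a n <= a n.+1) ->
  (forall n, a n <= b) -> forall e, 0 < e ->
  exists N, forall n, (N <= n)%N -> a n.+1 - a n < e.
Proof.
move=> am aB e e0.
have hs : has_sup (range a).
  by split; [exists (a 0%N), 0%N|exists b => _ [m _ <-]].
have [_ [N _ <-] Ne] := sup_adherent e0 hs.
exists N => n Nn.
have : a N <= a n.
  rewrite -(subnKC Nn); elim: (n - N)%N => [|k IH]; first by rewrite addn0.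
  by rewrite addnS (le_trans IH).
have : a n.+1 <= sup (range a) by apply: ub_le_sup; [exact: hs.2|exists n.+1].
by lra.
Qed.

End Topology.

Section Invariant.
Context {R : realType} {d : nat}.
Variable F : 'rV[R]_d -> 'rV[R]_d.
Implicit Types (K A B : set 'rV[R]_d) (x y z : 'rV[R]_d).

(** The intersection of the iterated images of [K], written pointwise so that each point comes with
    preimages of every depth. The box of side 2 yields Gamma and [shell] yields Sigma. *)
Definition maximal_invariant K : set 'rV[R]_d :=
  [set x | forall n, exists2 y, K y & iter n F y = x].

Lemma maximal_invariant_sub K : maximal_invariant K `<=` K.
Proof. by move=> x /(_ 0%N)[y Ky <-]. Qed.

Lemma maximal_invariantS K B : K `<=` B -> maximal_invariant K `<=` maximal_invariant B.
Proof. by move=> KB x xK n; have [y Ky <-] := xK n; exists y => //; exact: KB. Qed.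

Variables (O K : set 'rV[R]_d).
Hypothesis F_inj : forall x y, O x -> O y -> F x = F y -> x = y.
Hypothesis F_O : forall x, O x -> O (F x).
Hypothesis K_O : K `<=` O.
Hypothesis F_K : forall x, K x -> K (F x).
Hypothesis K_compact : compact K.
Hypothesis F_cont : {within K, continuous F}.

Let L := maximal_invariant K.

Lemma iter_stable B n x : (forall y, B y -> B (F y)) -> B x -> B (iter n F x).
Proof. by move=> FB Bx; elim: n => //= n; exact: FB. Qed.

Lemma iter_inj n x y : O x -> O y -> iter n F x = iter n F y -> x = y.
Proof.
by move=> Ox Oy; elim: n => //= n IH /F_inj e; apply/IH/e; exact: iter_stable.
Qed.

(** By injectivity all preimages of a point lie on a single backward orbit, so its one-step preimage
    in [K] itself has preimages of every depth. *)
Lemma maximal_invariant_image : F @` L = L.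
Proof.
apply/seteqP; split=> [_ [x Lx <-] [|n]|x Lx].
- by exists (F x) => //; apply: F_K; exact: maximal_invariant_sub.
- by have [y Ky <-] := Lx n; exists y.
have [y Ky yx] := Lx 1%N; exists y => // n.
have [z Kz zx] := Lx n.+1; exists z => //.
apply: F_inj; [|exact: K_O|by rewrite -iterS zx -yx].
by apply: iter_stable => //; exact: K_O.
Qed.

Lemma maximal_invariant_stable x : L x -> L (F x).
Proof. by move=> Lx; rewrite -maximal_invariant_image; exists x. Qed.

Lemma maximal_invariant_preimage n x : L x -> exists2 y, L y & iter n F y = x.
Proof.
elim: n x => [|n IH] x Lx; first by exists x.
have /IH[y Ly yx] := Lx.
have [z Lz zy] : (F @` L) y by rewrite maximal_invariant_image.
by exists z => //; rewrite iterSr zy.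
Qed.

Lemma maximal_invariant_backward n x : O x -> L (iter n F x) -> L x.
Proof.
move=> Ox /(maximal_invariant_preimage n)[y Ly] yx; suff <- : y = x by [].
by apply: iter_inj yx => //; apply: K_O; exact: maximal_invariant_sub.
Qed.

Lemma maximal_invariant_orbit x : L x -> exists p : nat -> 'rV[R]_d,
  [/\ p 0%N = x, forall n, L (p n) & forall n, F (p n.+1) = p n].
Proof.
move=> Lx; have [p pP] := @choice _ _ (fun n y => L y /\ iter n F y = x)
  (fun n => let: ex_intro2 y Ly yx := maximal_invariant_preimage n Lx in
            ex_intro _ y (conj Ly yx)).
exists p; split=> [|n|n]; [exact: (pP 0%N).2|exact: (pP n).1|].
have LO y : L y -> O y by move=> /maximal_invariant_sub /K_O.
apply: (@iter_inj n); [by apply/F_O/LO; case: (pP n.+1)|by apply/LO; case: (pP n)|].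
by rewrite -iterSr (pP n.+1).2 (pP n).2.
Qed.

Lemma iter_image_compact n : compact (iter n F @` K) /\ iter n F @` K `<=` K.
Proof.
elim: n => [|n [IHc IHs]]; first by rewrite (_ : iter 0 F @` K = K) ?image_id//; split.
have -> : iter n.+1 F @` K = F @` (iter n F @` K) by rewrite -image_comp.
split; last by move=> _ [y /IHs Ky <-]; exact: F_K.
by apply: continuous_compact IHc; apply: continuous_subspaceW F_cont.
Qed.

Lemma maximal_invariant_bigcap : L = \bigcap_n (iter n F @` K).
Proof. by apply/seteqP; split=> x Lx n => [_|]; have := Lx n; [|apply]. Qed.

Lemma maximal_invariant_compact : compact L.
Proof.
apply: (@subclosed_compact _ L K) => //; last exact: maximal_invariant_sub.
rewrite maximal_invariant_bigcap; apply: closed_bigI => n _.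
by apply: row_compact_closed; case: (iter_image_compact n).
Qed.

(** If attraction fails, choose failing iterates [w k] that have spent at least [k] steps in [K].
    Each iterated image of [K] is closed and contains all but finitely many [w k], so a cluster
    point lies in [L], a contradiction. *)
Lemma maximal_invariant_attracts A : (exists N, forall x, A x -> K (iter N F x)) ->
  attracts F L A.
Proof.
move=> [N AK] e e0; apply: contrapT => H.
have bad k : exists p : nat * 'rV[R]_d, [/\ (N + k <= p.1)%N, A p.2 &
    ~ (edist_inf L (iter p.1 F p.2) < e%:E)%E].
  apply: contrapT => Hk; apply: H; exists (N + k)%N => n x Nn Ax.
  by apply: contrapT => Hx; apply: Hk; exists (n, x).
have [p pP] := @choice _ _ _ bad.
pose w k := iter (p k).1 F (p k).2.
have wK k m : (m <= k)%N -> (iter m F @` K) (w k).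
  move=> mk; have [pk Ap _] := pP k.
  exists (iter ((p k).1 - N - m) F (iter N F (p k).2)).
    by apply: iter_stable => //; exact: AK.
  by rewrite -!iterD /w; congr iter; lia.
have [|z Kz zw] := @cluster_sequence _ _ _ w K_compact.
  by move=> k; have [y Ky] := wK k 0%N isT; rewrite /= => <-.
have Lz : L z.
  rewrite maximal_invariant_bigcap => m _; apply: closed_adherent => [|eps eps0].
    by apply: row_compact_closed; case: (iter_image_compact m).
  by have [k mk wz] := zw eps eps0 m; exists (w k) => //; exact: wK.
have [k _ wz] := zw (e / 2) ltac:(by rewrite divr_gt0) 0%N.
have [_ _] := pP k; apply.
apply: (@le_lt_trans _ _ (e / 2)%:E); last by rewrite lte_fin; lra.
apply: (@le_trans _ _ (edist (w k, z))); first by apply: ereal_inf_lbound; exists z.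
apply: edist_fin; first by rewrite divr_gt0.
by rewrite /= -ball_normE.
Qed.

End Invariant.

(** * Retrotone maps *)

(* [cpl i j] means that the growth rate of species [i] depends strictly on
   species [j]. *)
Record retrotone {R : realType} {d : nat} (cpl : rel 'I_d)
    (F : 'rV[R]_d -> 'rV[R]_d) : Prop := Retrotone {
  rt_orthant : forall x, orthant x -> orthant (F x);
  rt_bounds : forall M, 1 <= M -> exists2 m, 0 < m & forall x, box M x ->
    forall i, m * x ord0 i <= F x ord0 i /\ m * F x ord0 i <= x ord0 i;
  rt_lipschitz : forall M, 1 <= M -> exists2 K, 0 < K & forall x y,
    box M x -> box M y -> `|F x - F y| <= K * `|x - y|;
  rt_axis : forall i, F (delta_mx ord0 i) = delta_mx ord0 i;
  rt_below : forall y z, orthant y -> orthant z -> vle z (F y) ->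
    exists2 x, orthant x & F x = z;
  rt_open : forall y e, orthant y -> 0 < e -> exists2 dl, 0 < dl &
    forall z, orthant z -> `|z - F y| < dl ->
    exists x, [/\ orthant x, F x = z & `|x - y| < e];
  rt_weak : forall x y, orthant x -> orthant y -> vle (F x) (F y) -> vle x y;
  rt_strict : forall M, 1 <= M -> exists2 c, 0 < c & forall x y,
    box M x -> box M y -> vle (F x) (F y) -> forall i j, cpl i j ->
    x ord0 i * F y ord0 i * (1 + c * (F y ord0 j - F x ord0 j)) <=
    y ord0 i * F x ord0 i;
  rt_repel : exists dl q, [/\ 0 < dl, dl <= 1, 1 < q & forall x, box dl x ->
    forall i, q * x ord0 i <= F x ord0 i]
}.

Section Retrotone.
Context {R : realType} {d : nat}.
Variables (cpl : rel 'I_d) (F : 'rV[R]_d -> 'rV[R]_d).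
Hypothesis cpl_refl : forall i, cpl i i.
Hypothesis FR : retrotone cpl F.
Implicit Types (x y z : 'rV[R]_d) (M : R).

Lemma vle_antisym x y : vle x y -> vle y x -> x = y.
Proof. by move=> xy yx; apply/rowP => i; apply/le_anti; rewrite xy yx. Qed.

Lemma rt_inj x y : orthant x -> orthant y -> F x = F y -> x = y.
Proof.
by move=> x0 y0 e; apply: vle_antisym; apply: (rt_weak FR) => //; move=> i; rewrite e.
Qed.

Lemma iter_orthant n x : orthant x -> orthant (iter n F x).
Proof. by apply: iter_stable; exact: (rt_orthant FR). Qed.

Lemma iter_weak n x y : orthant x -> orthant y -> vle (iter n F x) (iter n F y) -> vle x y.
Proof.
by move=> x0 y0; elim: n => //= n IH /(rt_weak FR) H; apply/IH/H; exact: iter_orthant.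
Qed.

Lemma iter_below n y z : orthant y -> orthant z -> vle z (iter n F y) ->
  exists x, [/\ orthant x, vle x y & iter n F x = z].
Proof.
move=> y0; elim: n z => [|n IH] z z0 zy; first by exists z.
have [x x0 xz] := rt_below FR (iter_orthant n y0) z0 zy.
have [|w [w0 wy wx]] := IH x x0.
  by apply: (rt_weak FR) => //; [exact: iter_orthant|rewrite xz].
by exists w; split => //; rewrite iterS wx.
Qed.

Lemma iter_open n y e : orthant y -> 0 < e -> exists2 dl, 0 < dl &
  forall z, orthant z -> `|z - iter n F y| < dl ->
  exists x, [/\ orthant x, iter n F x = z & `|x - y| < e].
Proof.
move=> y0; elim: n e => [|n IH] e e0; first by exists e => // z z0 ze; exists z.
have [dl dl0 dlP] := IH e e0.
have [r r0 rP] := rt_open FR (iter_orthant n y0) dl0.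
exists r => // z z0 /(rP z z0)[w [w0 wz /(dlP w w0)[x [x0 xw xe]]]].
by exists x; split => //; rewrite iterS xw.
Qed.

Lemma rt_eq0 x i : orthant x -> (F x ord0 i = 0) <-> (x ord0 i = 0).
Proof.
move=> x0; have [M M1 xM] := orthant_box x0; have [m m0 mP] := rt_bounds FR M1.
have [h1 h2] := mP x xM i; have := x0 i; have := rt_orthant FR x0 i => Fx0 xi0.
split=> e; apply/le_anti; rewrite ?xi0 ?Fx0 andbT.
  by rewrite -(pmulr_rle0 _ m0) -e.
by rewrite -(pmulr_rle0 _ m0) -e.
Qed.

Lemma iter_eq0 n x i : orthant x -> (iter n F x ord0 i = 0) <-> (x ord0 i = 0).
Proof.
move=> x0; elim: n => //= n [IH1 IH2].
by split=> [/rt_eq0 H|/IH2 H]; [apply/IH1/H; exact: iter_orthant|apply/rt_eq0 => //; exact: iter_orthant].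
Qed.

Lemma iter_lipschitz n M : 1 <= M -> (forall x, box M x -> box M (F x)) ->
  exists2 C, 0 < C & forall x y,
  box M x -> box M y -> `|iter n F x - iter n F y| <= C * `|x - y|.
Proof.
move=> M1 FM; have [K K0 KP] := rt_lipschitz FR M1.
elim: n => [|n [C C0 CP]]; first by exists 1 => // x y _ _; rewrite mul1r.
exists (K * C) => [|x y xM yM]; first exact: mulr_gt0.
have iM z : box M z -> box M (iter n F z) by apply: iter_stable.
apply: le_trans (KP _ _ (iM x xM) (iM y yM)) _.
by rewrite -mulrA ler_wpM2l ?CP// ltW.
Qed.

Lemma delta_orthant i : orthant (delta_mx ord0 i : 'rV[R]_d).
Proof. by move=> j; rewrite mxE; case: (_ && _). Qed.

Lemma box_delta M i : 1 <= M -> box M (delta_mx ord0 i : 'rV[R]_d).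
Proof.
by move=> M1 j; rewrite mxE eqxx/=; case: eqVneq => _; rewrite /= ?lexx; lra.
Qed.

(* Compare [F x] with the fixed point [delta_mx ord0 i]. *)
Lemma contraction_above M : 1 <= M -> exists2 c, 0 < c & forall x, box M x ->
  forall i, 1 <= F x ord0 i -> F x ord0 i + c * (F x ord0 i - 1) <= x ord0 i.
Proof.
move=> M1; have [c c0 cP] := rt_strict FR M1; exists c => // x xM i Fx1.
have := cP (delta_mx ord0 i) x (box_delta i M1) xM _ i i (cpl_refl i).
rewrite (rt_axis FR) mxE !eqxx mul1r mulr1 => H.
have Fx0 : 0 <= F x ord0 i by apply: le_trans Fx1.
have : F x ord0 i * (1 + c * (F x ord0 i - 1)) <= x ord0 i.
  apply: H => j; rewrite mxE eqxx/=; have [->//|_] := eqVneq j i.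
  exact: (rt_orthant FR (box_orthant xM)).
apply: le_trans; rewrite [leRHS]mulrDr mulr1 lerD2l ler_peMl//.
by rewrite mulr_ge0 ?subr_ge0// ltW.
Qed.

Lemma box_stable M x : 1 <= M -> box M x -> box M (F x).
Proof.
move=> M1 xM i; rewrite (rt_orthant FR (box_orthant xM))/=.
have [c c0 cP] := contraction_above M1.
have [Fx1|/ltW Fx1] := leP 1 (F x ord0 i); last exact: le_trans M1.
have := cP x xM i Fx1; have /andP[_] := xM i.
have : 0 <= c * (F x ord0 i - 1) by rewrite mulr_ge0 ?subr_ge0// ltW.
by lra.
Qed.

(** The drop [c * (F x ord0 i - 1)] degenerates as the image approaches 1, so a box of side 1 might
    be reached only in the limit. While the image exceeds 2 the drop is at least [c] per step; hence
    the side 2. *)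
Lemma box_absorbed M : 1 <= M -> exists N, forall x, box M x -> box 2 (iter N F x).
Proof.
move=> M1; have [c c0 cP] := contraction_above M1.
have main n x : box M x -> box (Num.max 2 (M - n%:R * c)) (iter n F x).
  move=> xM; elim: n => [|n IH].
    by apply: box_sub xM; rewrite mul0r subr0 le_max lexx orbT.
  have itM : box M (iter n F x).
    by apply: (iter_stable n _ xM) => y; exact: box_stable.
  move=> i; rewrite iterS (rt_orthant FR (box_orthant itM))/= le_max.
  have [//|Fx2] := leP (F (iter n F x) ord0 i) 2.
  have := cP _ itM i ltac:(lra).
  have : c * 1 <= c * (F (iter n F x) ord0 i - 1) by rewrite ler_wpM2l ?(ltW c0)//; lra.
  have /andP[_] := IH i; rewrite le_max => /orP[|].
    by lra.
  by rewrite -natr1 mulrDl mul1r; lra.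
exists (Num.bound `|M / c|) => x /(main (Num.bound `|M / c|)).
apply: box_sub; rewrite ge_max lexx/=.
have : M / c < (Num.bound `|M / c|)%:R.
  by have := archi_boundP (normr_ge0 (M / c)); apply: le_lt_trans; exact: ler_norm.
by rewrite ltr_pdivrMr//; lra.
Qed.

End Retrotone.

(** * The attractor and the simplex of a retrotone map *)

Section Attractor.
Context {R : realType} {d : nat}.
Variables (cpl : rel 'I_d) (F : 'rV[R]_d -> 'rV[R]_d).
Hypothesis cpl_refl : forall i, cpl i i.
Hypothesis FR : retrotone cpl F.
Implicit Types (x y z : 'rV[R]_d) (M : R) (A : set 'rV[R]_d).
Variables dl q : R.
Hypothesis dl0 : 0 < dl.
Hypothesis dl1 : dl <= 1.
Hypothesis q1 : 1 < q.
Hypothesis repel : forall x, box dl x -> forall i, q * x ord0 i <= F x ord0 i.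

Definition attractor : set 'rV[R]_d := maximal_invariant F (box 2).

(* Points of [simplex] have a backward orbit that never enters the box of side
   [dl], in which 0 is repelling. *)
Definition shell : set 'rV[R]_d := [set x | box 2 x /\ exists i, dl <= x ord0 i].

Definition simplex : set 'rV[R]_d := maximal_invariant F shell.

Let le12 : 1 <= 2 :> R. Proof. by lra. Qed.
Let box_orth : box 2 `<=` (orthant : set 'rV[R]_d).
Proof. by move=> x; exact: box_orthant. Qed.
Let box2F x : box 2 x -> box 2 (F x).
Proof. exact: (box_stable cpl_refl FR). Qed.
Let Finj := rt_inj FR.
Let Forth := rt_orthant FR.

Lemma F_within M : 1 <= M -> {within box M, continuous F}.
Proof. by move=> M1; have [K _ /lipschitz_within] := rt_lipschitz FR M1. Qed.

Lemma shell_orthant : shell `<=` orthant.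
Proof. by move=> x [/box_orth]. Qed.

Lemma simplex_attractor : simplex `<=` attractor.
Proof. by apply: maximal_invariantS => x []. Qed.

Lemma attractor_box : attractor `<=` box 2.
Proof. exact: maximal_invariant_sub. Qed.

Lemma attractor_orthant : attractor `<=` orthant.
Proof. by move=> x /attractor_box/box_orth. Qed.

Lemma simplex_orthant : simplex `<=` orthant.
Proof. by move=> x /simplex_attractor/attractor_orthant. Qed.

Lemma attractor_compact : compact attractor.
Proof.
exact: (maximal_invariant_compact box2F (@box_compact _ _ 2) (F_within le12)).
Qed.

Lemma attractor_image : F @` attractor = attractor.
Proof. exact: (maximal_invariant_image Finj Forth box_orth box2F). Qed.

(** The preimages of [z] are found below those of [x], hence in the same box. *)
Lemma attractor_below x z : orthant z -> vle z x -> attractor x -> attractor z.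
Proof.
move=> z0 zx Gx n; have [y y2 yx] := Gx n.
have [|w [w0 wy wz]] := iter_below FR (n := n) (box_orth y2) z0; first by rewrite yx.
by exists w => //; exact: box_vle wy y2.
Qed.

Lemma attractor_attracts A : A `<=` orthant -> bounded_set A -> attracts F attractor A.
Proof.
move=> AO bA.
apply: (maximal_invariant_attracts box2F (@box_compact _ _ 2) (F_within le12)).
have [M [_ AM]] := bA.
have M1 : 1 <= `|M| + 1 by rewrite lerDr.
have [N NP] := box_absorbed cpl_refl FR M1.
exists N => x Ax; apply: NP => i; rewrite AO//=.
apply: le_trans (ler_norm _) _; apply: le_trans (coord_le_norm _ _) _.
by apply: AM => //; have := ler_norm M; lra.
Qed.

(** Repulsion speaks of points known to be small, while here only the image is. The image of the
    corner [y] dominates the whole small box, hence [F x], so [rt_weak] puts [x] below [y]. *)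
Lemma small_preimage x : orthant x -> box dl (F x) -> forall i, q * x ord0 i <= F x ord0 i.
Proof.
move=> x0 Fx; apply: repel.
pose y : 'rV[R]_d := const_mx dl.
have yb : box dl y by move=> i; rewrite mxE lexx ltW.
have : vle x y.
  apply: (rt_weak FR) => //; first exact: box_orthant yb.
  move=> i; apply: le_trans (repel yb i); rewrite mxE.
  have /andP[_] := Fx i; move/le_trans; apply; rewrite ler_peMl// ltW//.
by move=> xy; apply: box_vle yb.
Qed.

Lemma small_preimage_lt e x : orthant x -> e <= dl -> (forall i, F x ord0 i < e) ->
  forall i, q * x ord0 i < e.
Proof.
move=> x0 edl Fx i; apply: le_lt_trans (Fx i); apply: small_preimage => // j.
by rewrite Forth//= (le_trans _ edl)// ltW.
Qed.

Lemma shell_stable x : shell x -> shell (F x).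
Proof.
move=> [x2 [i xi]]; split; first exact: box2F.
apply: contrapT => /forallNP H.
have := @small_preimage_lt dl x (box_orth x2) (lexx _) _ i.
have xi0 : x ord0 i <= q * x ord0 i by rewrite ler_peMl ?(box_orth x2)// ltW.
move=> /(_ _) h; have : x ord0 i < dl.
  by apply: le_lt_trans xi0 (h _) => j; rewrite ltNge; apply/negP/H.
by rewrite ltNge xi.
Qed.

Lemma shell_compact : compact shell.
Proof.
have -> : shell = box 2 `&` [set x | exists i, dl <= x ord0 i] by [].
apply: compact_closedI; first exact: box_compact.
apply: adherent_closed => z zP; apply: contrapT => /forallNP H.
have [||e e0 eP] := @min_exists_pos R 'I_d (fun i e => z ord0 i <= dl - e).
- by move=> i a b ab; lra.
- move=> i; exists (dl - z ord0 i); last by lra.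
  by rewrite subr_gt0 ltNge; apply/negP/H.
have [y [i yi] yz] := zP e e0.
have := le_lt_trans (coord_le_norm _ i) yz; rewrite !mxE => yzi.
by have := le_lt_trans (ler_norm _) yzi; have := eP i; lra.
Qed.

Lemma shell_within : {within shell, continuous F}.
Proof. by apply: continuous_subspaceW (F_within le12) => x []. Qed.

Lemma simplex_compact : compact simplex.
Proof. exact: (maximal_invariant_compact shell_stable shell_compact shell_within). Qed.

Lemma simplex_image : F @` simplex = simplex.
Proof. exact: (maximal_invariant_image Finj Forth shell_orthant shell_stable). Qed.

Lemma simplex_attracts A : A `<=` orthant -> bounded_set A -> ~ closure A 0 ->
  attracts F simplex A.
Proof.
move=> AO bA A0.
apply: (maximal_invariant_attracts shell_stable shell_compact shell_within).
have [e e0 eA] : exists2 e : R, 0 < e & forall x, A x -> exists i, e <= x ord0 i.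
  apply: contrapT => H; apply: A0 => B /nbhs_ballP[e /= e0 eB].
  apply: contrapT => AB; apply: H; exists (e / 2); first by rewrite divr_gt0.
  move=> x Ax; apply: contrapT => /forallNP xe; apply: AB; exists x; split => //.
  apply: eB; rewrite -ball_normE /ball_/= sub0r normrN.
  apply: (@le_lt_trans _ _ (e / 2)); last by lra.
  apply: row_norm_le => [|i]; first by rewrite divr_ge0// ltW.
  by rewrite ger0_norm ?AO// leNgt; apply/negP => /ltW; exact: xe.
have [M [_ AM]] := bA.
have M1 : 1 <= `|M| + 1 by rewrite lerDr.
have [N NP] := box_absorbed cpl_refl FR M1.
have xM x : A x -> box (`|M| + 1) x.
  move=> Ax i; rewrite AO//=.
  apply: le_trans (ler_norm _) _; apply: le_trans (coord_le_norm _ _) _.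
  by apply: AM => //; have := ler_norm M; lra.
(* The Bernoulli minorant of [e * q ^+ n]: linear in [n], yet enough to pass [dl] after a number of
   steps common to all of [A]. *)
pose lvl n := e * (1 + n%:R * (q - 1)).
have lvlS n : lvl n.+1 <= q * lvl n.
  have : 0 <= (q - 1) * (e * (n%:R * (q - 1))).
    by rewrite !mulr_ge0// ?subr_ge0 ltW.
  by rewrite /lvl -natr1; lra.
have up n x : A x -> exists i, Num.min dl (lvl n) <= iter n F x ord0 i.
  move=> Ax; elim: n => [|n [i IH]].
    by have [i xi] := eA x Ax; exists i; rewrite /lvl mul0r addr0 mulr1 ge_min xi orbT.
  apply: contrapT => /forallNP H.
  have x0 := iter_orthant FR n (AO _ Ax).
  have mdl : Num.min dl (lvl n.+1) <= dl by rewrite ge_min lexx.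
  have := small_preimage_lt x0 mdl _ i.
  have lt j : F (iter n F x) ord0 j < Num.min dl (lvl n.+1).
    by rewrite ltNge; apply/negP/H.
  move=> /(_ lt); rewrite lt_min => /andP[h1 h2].
  have q0 := lt_trans ltr01 q1.
  move: IH; rewrite ge_min => /orP[h|h]; have := ler_wpM2l (ltW q0) h.
    have : dl <= q * dl by rewrite ler_peMl// ltW.
    by lra.
  by have := lvlS n; lra.
have [k kP] : exists k : nat, dl <= lvl k.
  exists (Num.bound `|dl / (e * (q - 1))|).
  set k := Num.bound _.
  have : dl / (e * (q - 1)) < k%:R.
    by have := archi_boundP (normr_ge0 (dl / (e * (q - 1)))); apply: le_lt_trans; exact: ler_norm.
  by rewrite ltr_pdivrMr ?mulr_gt0 ?subr_gt0// /lvl; lra.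
have lvl_le n : lvl n <= lvl n.+1.
  have : 0 <= e * (q - 1) by rewrite mulr_ge0 ?subr_ge0// ltW.
  by rewrite /lvl -natr1; lra.
exists (N + k)%N => x Ax; split.
  by rewrite addnC iterD; exact: (iter_stable k box2F (NP x (xM x Ax))).
have [i] := up (N + k)%N x Ax.
have kN : dl <= lvl (N + k)%N by elim: (N) => //= m; move/le_trans; apply.
by move=> h; exists i; apply: le_trans h; rewrite le_min lexx.
Qed.

(** The image of the corner dominates the small box, so every point of that box has a preimage, and
    [small_preimage] places it in the box again. *)
Lemma small_attractor x : box dl x -> attractor x.
Proof.
move=> xdl n; suff [y ydl <-] : exists2 y, box dl y & iter n F y = x.
  by exists y => //; apply: box_sub ydl; apply: le_trans dl1 le12.
elim: n x xdl => [|n IH] x xdl; first by exists x.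
pose y : 'rV[R]_d := const_mx dl.
have yb : box dl y by move=> i; rewrite mxE lexx ltW.
have xy : vle x (F y).
  move=> i; apply: le_trans (repel yb i); rewrite mxE.
  by have /andP[_] := xdl i; move/le_trans; apply; rewrite ler_peMl// ltW.
have [z z0 zx] := rt_below FR (box_orthant yb) (box_orthant xdl) xy.
have [|w wdl wz] := IH z; last by exists w => //; rewrite iterS wz.
move=> i; rewrite z0/=; have := @small_preimage z z0; rewrite zx => /(_ xdl i).
have /andP[_] := xdl i => h1 h2; apply: le_trans h1; apply: le_trans h2.
by rewrite ler_peMl// ltW.
Qed.

(* The ratios [r n] of the backward orbits of [z] and [x] are nonincreasing,
   and [w n.+1] is bounded by a multiple of [r n - r n.+1]. *)
Lemma simplex_not_below x z lam : attractor x -> lam < 1 -> vle z (lam *: x) ->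
  ~ simplex z.
Proof.
move=> Gx l1 zx Sz.
have [p [p0 pG pF]] := maximal_invariant_orbit Finj Forth box_orth box2F Gx.
have [w [w0 wS wF]] := maximal_invariant_orbit Finj Forth shell_orthant shell_stable Sz.
have p2 n : box 2 (p n) by exact: attractor_box (pG n).
have w2 n : box 2 (w n) by exact: attractor_box (simplex_attractor (wS n)).
have pO n := box_orth (p2 n); have wO n := box_orth (w2 n).
have [c c0 cP] := rt_strict FR le12; have [m m0 mP] := rt_bounds FR le12.
have lamp n : vle (w n) (lam *: p n) -> vle (w n) (p n).
  move=> h i; apply: le_trans (h i) _; rewrite mxE.
  by rewrite ler_piMl ?(pO n i)// ltW.
have wp n : vle (w n) (lam *: p n).
  elim: n => [|n IH]; first by rewrite w0 p0.
  have wpn : vle (F (w n.+1)) (F (p n.+1)) by rewrite wF pF; exact: lamp.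
  move=> i; rewrite mxE; have := pO n i; rewrite le_eqVlt => /predU1P[/esym pn0|pn0].
    have pn1 : p n.+1 ord0 i = 0 by apply/(rt_eq0 FR i (pO n.+1)); rewrite pF.
    by rewrite pn1 mulr0 -pn1; apply: (rt_weak FR).
  have := cP _ _ (w2 n.+1) (p2 n.+1) wpn i i (cpl_refl i); rewrite wF pF.
  have := IH i; rewrite mxE; have := lamp n IH i; have := wO n.+1 i; have := pO n.+1 i.
  move: (w n.+1 ord0 i) (p n.+1 ord0 i) (w n ord0 i) (p n ord0 i) pn0.
  move=> w' p' a b b0 p'0 w'0 ab alb h.
  have e1 : 0 <= w' * b * (c * (b - a)) by rewrite !mulr_ge0 ?subr_ge0// ltW.
  have e2 : p' * a <= p' * (lam * b) by rewrite ler_wpM2l.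
  by rewrite -(ler_pM2r b0); lra.
have vanish i : exists N, forall n, (N <= n)%N -> w n ord0 i < dl.
  have := pO 0%N i; rewrite le_eqVlt => /predU1P[/esym p00|p00].
    have pn0 n : p n ord0 i = 0.
      by elim: n => // n IH; apply/(rt_eq0 FR i (pO n.+1)); rewrite pF.
    by exists 0%N => n _; apply: le_lt_trans dl0; have := wp n i; rewrite mxE pn0 mulr0.
  have pn0 n : 0 < p n ord0 i.
    elim: n => // n IH; rewrite lt_neqAle pO andbT; apply/eqP => /esym/(rt_eq0 FR i (pO n.+1)).
    by rewrite pF => e; rewrite e ltxx in IH.
  pose r n := w n ord0 i / p n ord0 i.
  have r0 n : 0 <= r n by rewrite divr_ge0// ?wO ?pO.
  have wr n : w n ord0 i = r n * p n ord0 i by rewrite divfK// gt_eqF.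
  (* In coordinate [i] the gap between [p n] and [w n] is at least [1 - lam] times [p n], and [m]
     trades [p n] for [p n.+1]; the ratio [r n.+1] then turns [p n.+1] into [w n.+1]. *)
  have dec n : c * (1 - lam) * m * w n.+1 ord0 i <= r n - r n.+1.
    have wpn : vle (F (w n.+1)) (F (p n.+1)) by rewrite wF pF; exact/lamp/wp.
    have := cP _ _ (w2 n.+1) (p2 n.+1) wpn i i (cpl_refl i); rewrite wF pF.
    have := (mP _ (p2 n.+1) i).1; rewrite pF.
    have := wp n i; rewrite mxE.
    rewrite (wr n.+1); have := wr n.
    move: (r0 n) (r0 n.+1) (pn0 n) (pn0 n.+1).
    move: (r n) (r n.+1) (p n ord0 i) (p n.+1 ord0 i) (w n ord0 i).
    move=> a a' b b' v a0 a'0 b0 b'0 -> vb mb h.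
    have h1 : a' * (1 + c * (b - a * b)) <= a.
      by rewrite -(ler_pM2r b0) -(ler_pM2r b'0); lra.
    have h2 : a' * c * ((1 - lam) * b) <= a' * c * (b - a * b).
      by rewrite ler_wpM2l ?mulr_ge0// ?(ltW c0)//; lra.
    have h3 : a' * c * (1 - lam) * (m * b') <= a' * c * (1 - lam) * b.
      by rewrite ler_wpM2l ?mulr_ge0// ?(ltW c0)// subr_ge0 ltW.
    by lra.
  have e0 : 0 < c * (1 - lam) * m * dl by rewrite !mulr_gt0// subr_gt0.
  have [n|n|N NP] := @monotone_increments _ (fun n => - r n) 0 _ _ _ e0.
  - rewrite lerN2 -subr_ge0; apply: le_trans (dec n).
    by rewrite !mulr_ge0// ?wO ?subr_ge0// ltW.
  - by rewrite oppr_le0.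
  exists N.+1 => -[//|n] Nn; have := NP n Nn; have := dec n => h1 h2.
  have h3 : c * (1 - lam) * m * w n.+1 ord0 i < c * (1 - lam) * m * dl by lra.
  by move: h3; rewrite ltr_pM2l// !mulr_gt0// subr_gt0.
have [N NP] := eventually_all vanish.
have [_ [i]] := maximal_invariant_sub (wS N).
by rewrite leNgt NP.
Qed.

Lemma simplex_neq0 x : simplex x -> exists i, 0 < x ord0 i.
Proof.
by move=> /maximal_invariant_sub[_ [i xi]]; exists i; apply: lt_le_trans xi.
Qed.

(** Take the largest [rho] with [rho *: x] in the attractor. If an [n]-step preimage had all
    coordinates below [dl], openness of the iterate would pull a slightly larger multiple of [x]
    back into the small box, which lies in the attractor, contradicting maximality. *)
Lemma simplex_on_ray x : orthant x -> x <> 0 -> exists2 rho, 0 < rho & simplex (rho *: x).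
Proof.
move=> x0 xn0.
have rO t : 0 <= t -> orthant (t *: x) by move=> t0 i; rewrite mxE mulr_ge0.
have [i xi] : exists i, 0 < x ord0 i.
  apply: contrapT => /forallNP H; apply: xn0; apply/rowP => i; rewrite mxE.
  by apply/le_anti; rewrite x0 andbT leNgt; apply/negP/H.
pose T : set R := [set t | 0 <= t /\ attractor (t *: x)].
have hsT : has_sup T.
  split; first by exists 0; split => //; rewrite scale0r; apply: small_attractor => j; rewrite mxE lexx ltW.
  exists (2 / x ord0 i) => t [t0 /attractor_box/(_ i)]; rewrite mxE => /andP[_].
  by rewrite ler_pdivlMr.
pose rho := sup T.
have x1 : 0 < 1 + `|x| by rewrite ltr_pwDl.
have rho0 : 0 < rho.
  apply: (@lt_le_trans _ _ (dl / (1 + `|x|))); first by rewrite divr_gt0.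
  apply: ub_le_sup; first exact: hsT.2.
  have t0 : 0 <= dl / (1 + `|x|) by rewrite divr_ge0// ltW.
  split => //; apply: small_attractor => j; rewrite rO//= mxE mulrAC ler_pdivrMr//.
  rewrite ler_wpM2l ?(ltW dl0)//.
  apply: le_trans (ler_norm _) _; apply: le_trans (coord_le_norm _ _) _.
  by rewrite lerDr.
have rhoG : attractor (rho *: x).
  apply: closed_adherent; first by apply: row_compact_closed; exact: attractor_compact.
  move=> e e0; have [t [t0 tG] tr] := sup_adherent (divr_gt0 e0 x1) hsT.
  exists (t *: x) => //; rewrite -scalerBl normrZ.
  have tle : t <= rho by apply: ub_le_sup; [exact: hsT.2|exact: (conj t0 tG)].
  rewrite distrC ger0_norm ?subr_ge0//.
  have : rho - t < e / (1 + `|x|) by rewrite /rho; lra.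
  rewrite ltr_pdivlMr//; apply: le_lt_trans.
  by rewrite ler_wpM2l ?subr_ge0// lerDr.
exists rho => //; apply: contrapT => /existsNP[n nS].
have [y yG yx] := maximal_invariant_preimage Finj Forth box_orth box2F n rhoG.
have y2 := attractor_box yG; have yO := box_orth y2.
have ydl j : y ord0 j < dl.
  by rewrite ltNge; apply/negP => h; apply: nS; exists y => //; split => //; exists j.
have [||e e0 eP] := @min_exists_pos R 'I_d (fun j e => y ord0 j <= dl - e).
- by move=> j a b ab; lra.
- by move=> j; exists (dl - y ord0 j); [rewrite subr_gt0|lra].
have [e' e'0 e'P] := iter_open FR n yO e0.
pose s := e' / 2 / (1 + `|x|).
have s0 : 0 < s by rewrite !divr_gt0.
have [||y' [y'O y'x y'e]] := e'P ((rho + s) *: x).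
- by apply: rO; rewrite addr_ge0// ltW.
- rewrite yx -scalerBl (addrC rho) addrK normrZ gtr0_norm//.
  rewrite /s mulrAC ltr_pdivrMr//.
  have h : e' / 2 * `|x| <= e' / 2 * (1 + `|x|) by rewrite ler_wpM2l ?lerDr// divr_ge0// ltW.
  by apply: le_lt_trans h _; rewrite ltr_pM2r//; lra.
have y'dl : box dl y'.
  move=> j; rewrite y'O/=; have := le_lt_trans (coord_le_norm _ j) y'e; rewrite !mxE.
  by move=> /(le_lt_trans (ler_norm _)); have := eP j; lra.
have : T (rho + s).
  split; first by rewrite addr_ge0// ltW.
  rewrite -y'x; apply: iter_stable (small_attractor y'dl) => z.
  exact: (maximal_invariant_stable Finj Forth box_orth box2F).
move=> /(ub_le_sup hsT.2); rewrite -/rho; lra.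
Qed.

Lemma attractor_compact_attractor : compact_attractor F attractor.
Proof.
split.
- exists 0; apply: small_attractor => i; by rewrite mxE lexx ltW.
- exact: attractor_compact.
- exact: attractor_orthant.
- exact: attractor_image.
- exact: attractor_attracts.
Qed.

(** On a face, strict inequality in the coordinates of [I] gives a uniform factor [1 - e], since the
    remaining coordinates are 0 on both sides. *)
Lemma simplex_weakly_unordered : weakly_unordered simplex.
Proof.
move=> I I0 x y [Sx [x0 xI]] [Sy [y0 yI]] _ xy.
have [||e e0 eP] := @min_exists_pos R 'I_d (fun i e => x ord0 i <= (1 - e) * y ord0 i).
- move=> i a b ab; have := y0 i.
  by move=> yi0 /le_trans; apply; rewrite ler_wpM2r//; lra.
- move=> i; have [iI|iI] := boolP (i \in I); last first.
    by exists 1 => //; rewrite xI// yI// mulr0.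
  have yi : 0 < y ord0 i by apply: le_lt_trans (xy i iI).
  exists (1 - x ord0 i / y ord0 i); last by rewrite subKr divfK// gt_eqF.
  by rewrite subr_gt0 ltr_pdivrMr// mul1r; exact: xy.
apply: (simplex_not_below (simplex_attractor Sy) (_ : 1 - e < 1) _ Sx); first by lra.
by move=> i; rewrite mxE.
Qed.

(** The comparison is made one step back. A gap in a single coordinate [j] of the images lowers, by
    full coupling, every ratio of the preimages by the factor [(1 + e)^-1], so [simplex_not_below]
    applies to them. *)
Lemma simplex_unordered : (forall i j, cpl i j) -> unordered simplex.
Proof.
move=> cplT x y Sx Sy _ [xy xny].
have [j xj] : exists j, x ord0 j < y ord0 j.
  apply: contrapT => /forallNP H; apply: xny; apply/rowP => i; apply/le_anti.
  by rewrite xy leNgt; apply/negP/H.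
have SI := simplex_image.
have [x' Sx' x'x] : (F @` simplex) x by rewrite SI.
have [y' Sy' y'y] : (F @` simplex) y by rewrite SI.
have [c c0 cP] := rt_strict FR le12.
have xy' : vle (F x') (F y') by rewrite x'x y'y.
have x'y' := rt_weak FR (simplex_orthant Sx') (simplex_orthant Sy') xy'.
pose e := c * (y ord0 j - x ord0 j).
have e0 : 0 < e by rewrite mulr_gt0// subr_gt0.
have e1 : 0 < 1 + e by rewrite ltr_wpDl.
apply: (simplex_not_below (simplex_attractor Sy') (_ : (1 + e)^-1 < 1) _ Sx').
  by rewrite invf_lt1// ltrDl.
move=> i; rewrite mxE mulrC ler_pdivlMr//.
have := simplex_orthant Sy' i; rewrite le_eqVlt => /predU1P[/esym y0|y0].
  have -> : x' ord0 i = 0.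
    by apply/le_anti; rewrite (simplex_orthant Sx' i) andbT -y0.
  by rewrite mul0r y0.
have yi0 : 0 < y ord0 i.
  rewrite lt_neqAle (simplex_orthant Sy i) andbT; apply/eqP => /esym yi.
  by move: y0; rewrite (_ : y' ord0 i = 0) ?ltxx//; apply/(rt_eq0 FR i (simplex_orthant Sy')); rewrite y'y.
have := cP _ _ (attractor_box (simplex_attractor Sx')) (attractor_box (simplex_attractor Sy')) xy' i j (cplT i j).
rewrite x'x y'y -/e => h.
have h2 : y' ord0 i * x ord0 i <= y' ord0 i * y ord0 i by rewrite ler_pM2l.
by rewrite -(ler_pM2r yi0); lra.
Qed.

Lemma norm1E x : orthant x -> norm1 x = \sum_i x ord0 i.
Proof. by move=> x0; apply: eq_bigr => i _; rewrite ger0_norm. Qed.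

Lemma norm1_gt0 x i : orthant x -> 0 < x ord0 i -> 0 < norm1 x.
Proof.
move=> x0 xi; rewrite norm1E// (bigD1 i)//= ltr_wpDr// sumr_ge0//.
Qed.

Lemma norm1_continuous : continuous (@norm1 R d).
Proof.
rewrite /norm1; elim: (index_enum _) => [|i r IH] x.
  by under eq_fun do rewrite big_nil; exact: cst_continuous.
under eq_fun do rewrite big_cons.
have ci : continuous (fun z : 'rV[R]_d => `|z ord0 i|).
  move=> z; apply: (continuous_comp (@coord_continuous R 1 d ord0 i z)).
  exact: norm_continuous.
exact: cvgD (ci x) (IH x).
Qed.

Lemma radial_within A : (forall x, A x -> 0 < norm1 x) ->
  {within A, continuous (@radial_proj R d)}.
Proof.
move=> A0; apply: continuous_in_subspaceT => x /set_mem Ax.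
have n1 : {for x, continuous (fun y => (@norm1 R d y)^-1)}.
  by apply: continuousV; [rewrite gt_eqF// A0|exact: norm1_continuous].
exact: (continuousZ n1 (@cvg_id _ (nbhs x))).
Qed.

Lemma simplex_norm1 x : simplex x -> 0 < norm1 x.
Proof.
by move=> Sx; have [i xi] := simplex_neq0 Sx; apply: norm1_gt0 xi; exact: simplex_orthant.
Qed.

(** Two points of [simplex] on one ray would be multiples of each other, excluded by
    [simplex_not_below]; [simplex_on_ray] gives surjectivity, and compactness the continuity of the
    inverse. *)
Lemma simplex_radial : homeomorphism_on simplex std_simplex (@radial_proj R d).
Proof.
have inj x y : simplex x -> simplex y -> radial_proj x = radial_proj y -> x = y.
  wlog xy : x y / norm1 x <= norm1 y.
    by move=> H Sx Sy; have [/H|/ltW/H h /esym e] := leP (norm1 x) (norm1 y); [exact|apply/esym/h].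
  move=> Sx Sy e; have x1 := simplex_norm1 Sx; have y1 := simplex_norm1 Sy.
  have xE : x = (norm1 x / norm1 y) *: y.
    rewrite -scalerA -/(radial_proj y) -e /radial_proj scalerA divff ?scale1r//.
    by rewrite gt_eqF.
  move: xy; rewrite le_eqVlt => /predU1P[xy|xy].
    by rewrite xE xy divff ?scale1r// gt_eqF.
  exfalso; apply: (simplex_not_below (simplex_attractor Sy) (_ : norm1 x / norm1 y < 1) _ Sx).
    by rewrite ltr_pdivrMr// mul1r.
  by rewrite {1}xE => i.
have onto s : std_simplex s -> exists2 x, simplex x & radial_proj x = s.
  move=> [s0 s1]; have [|rho rho0 Sr] := simplex_on_ray s0.
    move=> sz; move: s1; rewrite sz big1 => [|i _]; last by rewrite mxE.
    by move/eqP; rewrite eq_sym oner_eq0.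
  exists (rho *: s) => //; rewrite /radial_proj.
  have -> : norm1 (rho *: s) = rho.
    rewrite norm1E; last exact: simplex_orthant.
    by under eq_bigr do rewrite mxE; rewrite -mulr_sumr s1 mulr1.
  by rewrite scalerA mulVf ?scale1r// gt_eqF.
have into x : simplex x -> std_simplex (radial_proj x).
  move=> Sx; have x1 := simplex_norm1 Sx; split.
    by move=> i; rewrite mxE mulr_ge0 ?invr_ge0 ?(ltW x1)//; exact: simplex_orthant.
  under eq_bigr do rewrite mxE.
  by rewrite -mulr_sumr -norm1E ?mulVf ?gt_eqF//; exact: simplex_orthant.
pose h s := xget (0 : 'rV[R]_d) [set x | simplex x /\ radial_proj x = s].
have hP s : std_simplex s -> simplex (h s) /\ radial_proj (h s) = s.
  by move=> /onto[x Sx xs]; apply: (@xgetPex _ 0 [set x | simplex x /\ radial_proj x = s]); exists x.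
have hr x : simplex x -> h (radial_proj x) = x.
  by move=> Sx; have [Sh e] := hP _ (into x Sx); apply: inj.
exists h; split.
- by move=> x Sx; split; [exact: into|exact: hr].
- exact: hP.
- exact: radial_within simplex_norm1.
have -> : std_simplex = @radial_proj R d @` simplex.
  by apply/seteqP; split=> [s /onto[x Sx <-]|_ [x /into ? <-]//]; exists x.
apply: compact_inverse_continuous hr.
  exact: simplex_compact.
exact: radial_within simplex_norm1.
Qed.

Lemma simplex_homeo : homeomorphism_on simplex simplex F.
Proof.
have SI := simplex_image.
have FS x : simplex x -> simplex (F x) by move=> Sx; rewrite -SI; exists x.
have onto y : simplex y -> exists2 x, simplex x & F x = y by rewrite -{1}SI => -[x]; exists x.
pose h y := xget (0 : 'rV[R]_d) [set x | simplex x /\ F x = y].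
have hP y : simplex y -> simplex (h y) /\ F (h y) = y.
  by move=> /onto[x Sx xs]; apply: (@xgetPex _ 0 [set x | simplex x /\ F x = y]); exists x.
have hr x : simplex x -> h (F x) = x.
  move=> Sx; have [Sh e] := hP _ (FS x Sx).
  by apply: Finj e; exact: simplex_orthant.
have FC : {within simplex, continuous F}.
  apply: continuous_subspaceW (F_within le12) => x /simplex_attractor; exact: attractor_box.
exists h; split => //.
- by move=> x Sx; split; [exact: FS|exact: hr].
- by have := compact_inverse_continuous simplex_compact FC hr; rewrite SI.
Qed.

Lemma simplex_is_core : simplex_core F simplex.
Proof.
split.
- exact: simplex_orthant.
- exact: simplex_radial.
- exact: simplex_image.
- exact: simplex_homeo.
- exact: simplex_attracts.
Qed.

(* The ratio of the [i]-th coordinates is monotone and bounded. *)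
Lemma ordered_orbits_asymptotic x y M i j : 1 <= M -> box M x -> box M y ->
  (forall n, vle (iter n F x) (iter n F y)) -> cpl i j -> 0 < x ord0 i ->
  forall e, 0 < e -> exists N, forall n, (N <= n)%N ->
    `|iter n F x ord0 j - iter n F y ord0 j| < e.
Proof.
move=> M1 xM yM xy ij xi e e0.
have FM z : box M z -> box M (F z) by exact: (box_stable cpl_refl FR).
have uM n : box M (iter n F x) by exact: (iter_stable n FM xM).
have vM n : box M (iter n F y) by exact: (iter_stable n FM yM).
have [c c0 cP] := rt_strict FR M1.
pose u n := iter n F x ord0 i; pose v n := iter n F y ord0 i.
have pos z n : orthant z -> 0 < z ord0 i -> 0 < iter n F z ord0 i.
  move=> z0 zi; rewrite lt_neqAle (iter_orthant FR)// andbT; apply/eqP => /esym.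
  by move=> /(iter_eq0 FR n i z0) e'; move: zi; rewrite e' ltxx.
have u0 n : 0 < u n by apply: pos (box_orthant xM) xi.
have v0 n : 0 < v n.
  by apply: pos (box_orthant yM) _; apply: lt_le_trans xi (xy 0%N i).
pose r n := u n / v n.
have r0 n : 0 < r n by rewrite divr_gt0.
have r1 n : r n <= 1 by rewrite ler_pdivrMr// mul1r; exact: xy.
have ur n : u n = r n * v n by rewrite divfK// gt_eqF.
have inc n : r n * (c * (iter n.+1 F y ord0 j - iter n.+1 F x ord0 j)) <= r n.+1 - r n.
  have := cP _ _ (uM n) (vM n) (xy n.+1) i j ij.
  rewrite -!iterS -/(u n) -/(v n) -/(u n.+1) -/(v n.+1).
  rewrite !ur; set D := _ - _; move: (r n) (r n.+1) (v n) (v n.+1) (v0 n) (v0 n.+1).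
  move=> a a' b b' b0 b'0 h.
  have : a * (1 + c * D) <= a' by rewrite -(ler_pM2r b0) -(ler_pM2r b'0); lra.
  by lra.
have D0 n : 0 <= iter n F y ord0 j - iter n F x ord0 j by rewrite subr_ge0; exact: xy.
have rm n : r n <= r n.+1.
  rewrite -subr_ge0; apply: le_trans (inc n); rewrite mulr_ge0 ?(ltW (r0 n))//.
  by rewrite mulr_ge0 ?(ltW c0)//; exact: (D0 n.+1).
(* The increments bound the gap only after multiplication by [r n]. The ratio stays above its
   initial value, which is positive because [x ord0 i] is. *)
have rge n : r 0%N <= r n by elim: n => // n /le_trans; apply.
have re : 0 < r 0%N * c * e by rewrite mulr_gt0// mulr_gt0//; exact: r0.
have [N NP] := monotone_increments rm r1 re.
exists N.+1 => -[//|n] Nn; rewrite distrC (ger0_norm (D0 n.+1)).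
have := NP n Nn; have := inc n; have := D0 n.+1; move: (_ - iter n.+1 F x ord0 j) => D DD h1 h2.
have h3 : r 0%N * (c * D) <= r n * (c * D) by rewrite ler_wpM2r// mulr_ge0// ltW.
have h4 : r 0%N * c * D < r 0%N * c * e by lra.
by move: h4; rewrite ltr_pM2l// mulr_gt0//; exact: r0.
Qed.

Lemma asymptoticP x y :
  (forall j e, 0 < e -> exists N, forall n, (N <= n)%N ->
    `|iter n F x ord0 j - iter n F y ord0 j| < e) ->
  `|iter n F x - iter n F y| @[n --> \oo] --> (0 : R).
Proof.
move=> H; apply/cvgrPdist_le => e e0.
have [N NP] := eventually_all (fun j => H j e e0).
exists N => // n /= Nn; rewrite sub0r normrN normr_id.
by apply: row_norm_le => [|j]; [exact: ltW|rewrite !mxE; apply/ltW/NP].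
Qed.

(* [y] is a limit point of the sequence [yn]. *)
Lemma shadow x : orthant x -> x <> 0 -> exists yn : nat -> 'rV[R]_d, exists rho : nat -> R,
  [/\ forall n, 0 < rho n, forall n, simplex (yn n),
      forall n, iter n F (yn n) = rho n *: iter n F x & exists2 y, simplex y &
   forall k i e, 0 < e -> exists2 n, (k <= n)%N &
     `|iter k F (yn n) ord0 i - iter k F y ord0 i| < e].
Proof.
move=> x0 xn0.
have ray n : exists p : 'rV[R]_d * R, [/\ 0 < p.2, simplex p.1 & iter n F p.1 = p.2 *: iter n F x].
  have [|rho rho0 Sr] := simplex_on_ray (iter_orthant FR n x0).
    move=> H; apply: xn0; apply/rowP => i; rewrite mxE; apply/(iter_eq0 FR n i x0).
    by rewrite H mxE.
  have [y Sy yr] := maximal_invariant_preimage Finj Forth shell_orthant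
    shell_stable n Sr.
  by exists (y, rho).
have [p pP] := @choice _ _ _ ray.
exists (fun n => (p n).1), (fun n => (p n).2); split=> [n|n|n|]; try by case: (pP n).
have Sp n : simplex (p n).1 by case: (pP n).
have [y Sy yp] := cluster_sequence simplex_compact Sp.
exists y => // k i e e0.
have [C C0 CP] := iter_lipschitz FR k le12 box2F.
(* Taking [n] at least [k] matters: the points share a ray at time [n], and their order there is
   carried back to time [k]. *)
have [n kn yn] := yp (e / C) (divr_gt0 e0 C0) k.
exists n => //.
have S2 z : simplex z -> box 2 z by move=> /simplex_attractor; exact: attractor_box.
have := CP _ _ (S2 _ (Sp n)) (S2 _ Sy); have := coord_le_norm (iter k F (p n).1 - iter k F y) i.
rewrite !mxE => h1 /(le_trans h1)/le_lt_trans; apply.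
by move: yn; rewrite ltr_pdivlMr// mulrC.
Qed.

(** Here [rho n] is at least 1, since otherwise a point of [simplex] would lie strictly inside the
    attractor on its ray; so the orbit of [x] stays below that of [y]. Faces are invariant in both
    directions, hence [y] vanishes wherever [x] does, and each remaining coordinate is controlled by
    its own ratio. *)
Lemma attractor_phase : asymptotically_phased F attractor simplex.
Proof.
move=> x Gx xn0; have x0 := attractor_orthant Gx.
have [yn [rho [rho0 Sn ynE [y Sy yP]]]] := shadow x0 xn0.
have y0 := simplex_orthant Sy.
exists y => //.
have GS n z : attractor z -> attractor (iter n F z).
  apply: iter_stable => w; exact: (maximal_invariant_stable Finj Forth box_orth box2F).
have rho1 n : 1 <= rho n.
  rewrite leNgt; apply/negP => r1.
  apply: (simplex_not_below (GS n x Gx) r1 (z := rho n *: iter n F x)) => //.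
  rewrite -ynE; apply: iter_stable (Sn n) => w Sw.
  by rewrite -simplex_image; exists w.
have dom k n : (k <= n)%N -> vle (iter k F x) (iter k F (yn n)).
  move=> kn; apply: (@iter_weak _ _ cpl F FR (n - k)).
  - exact: (iter_orthant FR _ x0).
  - exact: (iter_orthant FR _ (simplex_orthant (Sn n))).
  rewrite -!iterD subnK// ynE => i; rewrite mxE ler_peMl//.
  exact: (iter_orthant FR n x0).
have xy k : vle (iter k F x) (iter k F y).
  move=> i; rewrite leNgt; apply/negP; rewrite -subr_gt0 => e0.
  have [n kn] := yP k i _ e0; have := dom k n kn i.
  by move=> h /ltr_normlP[_]; lra.
have y00 i : x ord0 i = 0 -> y ord0 i = 0.
  move=> xi; apply/le_anti; rewrite y0 andbT leNgt; apply/negP => yi.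
  have [n _] := yP 0%N i _ yi; rewrite /=.
  have -> : yn n ord0 i = 0.
    by apply/(iter_eq0 FR n i (simplex_orthant (Sn n))); rewrite ynE mxE (iter_eq0 FR n i x0).2 ?mulr0.
  by rewrite sub0r normrN gtr0_norm// ltxx.
apply: asymptoticP => j e e0.
have := x0 j; rewrite le_eqVlt => /predU1P[/esym xj|xj].
  exists 0%N => n _; rewrite (iter_eq0 FR n j x0).2//.
  by rewrite (iter_eq0 FR n j y0).2 ?y00// subrr normr0.
apply: (ordered_orbits_asymptotic (i := j) le12) => //.
- exact: attractor_box.
- by apply: attractor_box; exact: simplex_attractor.
Qed.

(** For [x] outside the attractor [rho n] is at most 1, since otherwise an iterate of [x], and with
    it [x], would lie in the attractor. So [y] lies below [x] and may vanish where [x] does not;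
    full coupling lets one positive coordinate [i] of [y] control the gaps in all coordinates. *)
Lemma orthant_phase : (forall i j, cpl i j) -> asymptotically_phased F orthant simplex.
Proof.
move=> cplT x x0 xn0.
have [Gx|nGx] := pselect (attractor x); first exact: attractor_phase.
have [yn [rho [rho0 Sn ynE [y Sy yP]]]] := shadow x0 xn0.
have y0 := simplex_orthant Sy.
exists y => //.
have rho1 n : rho n <= 1.
  rewrite leNgt; apply/negP => r1; apply: nGx.
  apply: (maximal_invariant_backward Finj Forth box_orth box2F (n := n) x0).
  apply: (@attractor_below (rho n *: iter n F x)).
  - exact: (iter_orthant FR n x0).
  - by move=> i; rewrite mxE ler_peMl ?(iter_orthant FR n x0)// ltW.
  - rewrite -ynE; apply: iter_stable (simplex_attractor (Sn n)) => w.
    exact: (maximal_invariant_stable Finj Forth box_orth box2F).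
have dom k n : (k <= n)%N -> vle (iter k F (yn n)) (iter k F x).
  move=> kn; apply: (@iter_weak _ _ cpl F FR (n - k)).
  - exact: (iter_orthant FR _ (simplex_orthant (Sn n))).
  - exact: (iter_orthant FR _ x0).
  rewrite -!iterD subnK// ynE => i; rewrite mxE ler_piMl//.
  exact: (iter_orthant FR n x0).
have yx k : vle (iter k F y) (iter k F x).
  move=> i; rewrite leNgt; apply/negP; rewrite -subr_gt0 => e0.
  have [n kn] := yP k i _ e0; have := dom k n kn i.
  by rewrite distrC => h /ltr_normlP[_]; lra.
have [i yi] := simplex_neq0 Sy.
have [M M1 xM] := orthant_box x0.
have yM : box M y := box_vle y0 (yx 0%N) xM.
apply: asymptoticP => j e e0.
have [N NP] := ordered_orbits_asymptotic M1 yM xM yx (cplT i j) yi e0.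
by exists N => n /NP; rewrite distrC.
Qed.

End Attractor.

(** * Existence for retrotone maps and for Kolmogorov systems *)

Section Existence.
Context {R : realType} {d : nat}.
Variables (cpl : rel 'I_d) (F : 'rV[R]_d -> 'rV[R]_d).
Hypothesis cpl_refl : forall i, cpl i i.
Hypothesis FR : retrotone cpl F.

Theorem weak_carrying_simplex_exists : exists Sigma, weak_carrying_simplex F Sigma.
Proof.
have [dl [q [dl0 dl1 q1 repel]]] := rt_repel FR.
exists (simplex F dl), (attractor F).
  exact: (attractor_compact_attractor cpl_refl FR dl0 dl1 q1 repel).
split.
- exact: simplex_attractor.
- exact: (simplex_weakly_unordered cpl_refl FR dl0 q1 repel).
- exact: (simplex_is_core cpl_refl FR dl0 dl1 q1 repel).
- exact: (attractor_phase cpl_refl FR dl0 dl1 q1 repel).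
Qed.

Theorem carrying_simplex_exists : (forall i j, cpl i j) ->
  exists Sigma, carrying_simplex F Sigma.
Proof.
move=> cplT; have [dl [q [dl0 dl1 q1 repel]]] := rt_repel FR.
exists (simplex F dl), (attractor F).
  exact: (attractor_compact_attractor cpl_refl FR dl0 dl1 q1 repel).
split.
- exact: simplex_attractor.
- exact: (simplex_unordered cpl_refl FR dl0 q1 repel cplT).
- exact: (simplex_is_core cpl_refl FR dl0 dl1 q1 repel).
- exact: (orthant_phase cpl_refl FR dl0 dl1 q1 repel cplT).
Qed.

End Existence.

Lemma time_one_map_retrotone (R : realType) (d : nat) (g : 'rV[R]_d -> 'rV[R]_d)
    (U : set 'rV[R]_d) (G : 'rV[R]_d -> 'rV[R]_d) (cpl : rel 'I_d) :
  C1_extension g U G ->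
  (forall i : 'I_d, g (delta_mx ord0 i) ord0 i = 0) ->
  (forall x, orthant x -> forall i j, deriv_mx G x i j <= 0) ->
  (forall x, orthant x -> forall i, deriv_mx G x i i < 0) ->
  (forall x, orthant x -> forall i j, cpl i j -> deriv_mx G x i j < 0) ->
  retrotone cpl (time_one_map g).
Proof.
move=> g_C1 g_axis Dg_le0 Dg_diag Dg_cpl.
have g_lip := C1_lipschitz g_C1; have g_anti := C1_antitone g_C1 Dg_le0.
split.
- exact: time_one_orthant.
- exact: time_one_bounds.
- exact: time_one_lipschitz.
- exact: time_one_axis.
- exact: time_one_preimage_below.
- exact: time_one_open.
- exact: time_one_retrotone_weak.
- move=> M M1; apply: time_one_retrotone => //.
  by apply: (C1_strict g_C1 Dg_le0); [exact: lt_le_trans M1|exact: Dg_cpl].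
(* Repulsion at 0: the [i]-th growth rate is 0 at the [i]-th basis vector and strictly decreasing
   along that axis, so it is at least [c] at 0. *)
have [|c c0 cP] := @C1_strict R d g G U g_C1 Dg_le0 (fun i j => i == j) 1 ltr01.
  by move=> x x0 i j /eqP <-; exact: Dg_diag.
apply: (time_one_repelling g_lip g_anti g_axis c0) => i.
have b0 : box 1 (0 : 'rV[R]_d) by move=> j; rewrite mxE lexx ler01.
have be : box 1 (delta_mx ord0 i : 'rV[R]_d) by exact: box_delta.
have le0 : vle (0 : 'rV[R]_d) (delta_mx ord0 i) by move=> j; rewrite mxE delta_orthant.
by have := cP _ _ b0 be le0 i i (eqxx i); rewrite g_axis subr0 !mxE !eqxx subr0 mulr1.
Qed.

Theorem theorem4p3 (R : realType) (d : nat) (g : 'rV[R]_d -> 'rV[R]_d)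
    (U : set 'rV[R]_d) (G : 'rV[R]_d -> 'rV[R]_d)
    (g_C1 : C1_extension g U G)
    (g_axis : forall i : 'I_d, g (delta_mx ord0 i) ord0 i = 0)
    (Dg_le0 : forall x, orthant x -> forall i j, deriv_mx G x i j <= 0)
    (Dg_diag_lt0 : forall x, orthant x -> forall i, deriv_mx G x i i < 0) :
  (exists Sigma, weak_carrying_simplex (time_one_map g) Sigma) /\
  ((forall x, orthant x -> forall i j, deriv_mx G x i j < 0) ->
   exists Sigma, carrying_simplex (time_one_map g) Sigma).
Proof.
split=> [|Dg_lt0].
  apply: (@weak_carrying_simplex_exists _ _ (fun i j => i == j)) => //.
  apply: (time_one_map_retrotone g_C1) => // x x0 i j /eqP <-.
  exact: Dg_diag_lt0.
apply: (@carrying_simplex_exists _ _ (fun _ _ => true)) => //.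
by apply: (time_one_map_retrotone g_C1) => // x x0 i j _; exact: Dg_lt0.
Qed.
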